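(* Let $Q=\{\bm{x}_n\}_{n=1}^\infty\subset\mathbb{R}^3$ be a countable dense subset (with the $\bm{x}_n$ pairwise distinct), let $\epsilon\in(0,2\pi]$ be a constant, and let $$E=\mathbb{R}^4-\bigcup_{n=1}^\infty\{\bm{x}_n\}\times\big((-\infty,-n\pi]\cup[n\pi+\epsilon,\infty)\big),$$ an open submanifold of $\mathbb{R}^4=\mathbb{R}^3\times\mathbb{R}$ with coordinates $(x,y,z,\theta)$. Let $\mathcal{D}$ be the restriction to $E$ of the distribution $\langle\partial_\theta,\ \cos(\theta/2)X+\sin(\theta/2)Y\rangle$, where $X=\partial_x-y\,\partial_z$ and $Y=\partial_y$. Then the automorphism group $\operatorname{Aut}(E,\mathcal{D})$ of the Engel manifold $(E,\mathcal{D})$ is trivial.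
   Context: An Engel structure on a $4$-manifold $E$ is a smooth rank $2$ distribution $\mathcal{D}\subset TE$ such that $\mathcal{D}^2=[\mathcal{D},\mathcal{D}]+\mathcal{D}$ is a distribution of rank $3$ and $\mathcal{D}^3=[\mathcal{D}^2,\mathcal{D}^2]+\mathcal{D}^2$ has rank $4$; the pair $(E,\mathcal{D})$ is then called an Engel manifold. $\operatorname{Aut}(E,\mathcal{D})$ is the group of diffeomorphisms $f:E\to E$ with $df(\mathcal{D})\subset\mathcal{D}$. *)

(* Defs.v *)
From HB Require Import structures.
From mathcomp Require Import all_boot all_order all_algebra.
From mathcomp Require Import all_classical all_reals all_analysis.

Set Implicit Arguments.
Unset Strict Implicit.
Unset Printing Implicit Defensive.

Import Order.TTheory GRing.Theory Num.Theory.
Import numFieldNormedType.Exports.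

Local Open Scope classical_set_scope.
Local Open Scope ring_scope.

Section Calculus.
Context {R : realType}.

Section Smooth.
Context {V W : normedModType R}.

(* Meant for open [U], and only depends on [f] on [U] in that case. *)
Fixpoint class_C (k : nat) (U : set V) (f : V -> W) : Prop :=
  match k with
  | 0 => forall p, U p -> {for p, continuous f}
  | k.+1 => (forall p, U p -> differentiable f p) /\
            (forall v : V, class_C k U ('D_v f))
  end.

Definition smooth_on (U : set V) (f : V -> W) : Prop :=
  forall k, class_C k U f.

End Smooth.

Definition lie_bracket {V : normedModType R} (X Y : V -> V) (p : V) : V :=
  'D_(X p) Y p - 'D_(Y p) X p.

Definition lspan {V : lmodType R} (A : set V) : set V :=
  [set v | exists (n : nat) (a : 'I_n -> R) (w : 'I_n -> V),
     (forall i, A (w i)) /\ v = \sum_(i < n) a i *: w i].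

End Calculus.

Section Distributions.
Context {R : realType} {n : nat}.
Local Notation E_n := 'rV[R]_n.

(* A family of sets of tangent vectors is a total function [D] on R^n; every
   notion below only looks at its restriction to the open set [U].
   The rows of [F q] form a local frame of [D]. *)
Definition smooth_distribution (k : nat) (U : set E_n) (D : E_n -> set E_n) :
    Prop :=
  forall p, U p -> exists (O : set E_n) (F : E_n -> 'M[R]_(k, n)),
    [/\ open O, O p, O `<=` U, smooth_on O F &
        forall q, O q -> row_free (F q) /\ D q = [set v | (v <= F q)%MS]].

Definition local_section (O : set E_n) (D : E_n -> set E_n) (X : E_n -> E_n) :
    Prop :=
  smooth_on O X /\ forall q, O q -> D q (X q).

(* The fibre at [p] of [D, D] + D. *)
Definition derived (U : set E_n) (D : E_n -> set E_n) (p : E_n) : set E_n :=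
  lspan [set v | exists O : set E_n, [/\ open O, O p, O `<=` U &
    (exists2 X, local_section O D X & v = X p) \/
    (exists X Y, [/\ local_section O D X, local_section O D Y &
                     v = lie_bracket X Y p])]].

End Distributions.

Section Engel.
Context {R : realType}.
Local Notation R4 := 'rV[R]_4.

Definition engel_manifold (E : set R4) (D : R4 -> set R4) : Prop :=
  [/\ open E, smooth_distribution 2 E D,
      smooth_distribution 3 E (derived E D) &
      smooth_distribution 4 E (derived E (derived E D))].

(* A self-map of [E] read in the ambient coordinates; the value 0 outside the
   open set [E] is irrelevant to the derivatives at points of [E]. *)
Definition ambient (E : set R4) (f : E -> E) : R4 -> R4 :=
  'valL_ (0 : R4) (fun p : E => val (f p)).

Definition diffeomorphism (E : set R4) (f : E -> E) : Prop :=
  smooth_on E (ambient f) /\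
  exists g : E -> E, [/\ cancel f g, cancel g f & smooth_on E (ambient g)].

Definition Aut (E : set R4) (D : R4 -> set R4) : set (E -> E) :=
  [set f | diffeomorphism f /\
     forall (p : E) (v : R4),
       D (val p) v -> D (val (f p)) ('d (ambient f) (val p) v)].

End Engel.

Arguments Aut {R} E D _.

Section Example.
Context {R : realType}.
Local Notation R4 := 'rV[R]_4.

Definition coord_y (p : R4) : R := p 0 1.
Definition coord_theta (p : R4) : R := p 0 3.

Definition d_x : R4 := delta_mx 0 0.
Definition d_y : R4 := delta_mx 0 1.
Definition d_z : R4 := delta_mx 0 2.
Definition d_theta : R4 := delta_mx 0 3.

Definition field_X (p : R4) : R4 := d_x - coord_y p *: d_z.
Definition field_Y (p : R4) : R4 := d_y.

Definition dist_D (p : R4) : set R4 :=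
  [set v | exists a b : R,
     v = a *: d_theta +
         b *: (cos (coord_theta p / 2) *: field_X p +
               sin (coord_theta p / 2) *: field_Y p)].

Definition point4 (x : 'rV[R]_3) (t : R) : R4 := row_mx x (t%:M : 'rV[R]_1).

(* [x i] stands for the point x_(i+1), whence the factors [i.+1]. *)
Definition domain_E (x : nat -> 'rV[R]_3) (eps : R) : set R4 :=
  ~` \bigcup_(i : nat)
       [set point4 (x i) t | t in `]-oo, - (i.+1%:R * pi)] `|`
                                  `[i.+1%:R * pi + eps, +oo[].

End Example.

(* Main.v *)
Require Import Defs.
From mathcomp Require Import all_boot all_order all_algebra.
From mathcomp Require Import all_classical all_reals all_analysis.
From mathcomp Require Import ring lra.

Set Implicit Arguments.
Unset Strict Implicit.
Unset Printing Implicit Defensive.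

Import Order.TTheory GRing.Theory Num.Theory.
Import numFieldNormedType.Exports.

Local Open Scope classical_set_scope.
Local Open Scope ring_scope.

(** Write a map of the domain in coordinates as [f = (u, v, w, t)], let [alpha]
be the contact form [dz + y dx] on R^3, and put
[B = cos(theta/2) X + sin(theta/2) Y], so that the distribution is spanned by
[d_theta] and [B].

That the distribution is Engel is a pointwise computation: [[d_theta, B]] turns
[B] by a quarter turn, so the first derived distribution is the kernel of
[alpha] ([derived_dist_D]), and [[X, Y] = d_z] provides the missing direction
([derived_contact]).

For the rigidity, let [f] preserve the distribution.

The vertical direction is intrinsic, being the characteristic direction of
[ker alpha].  Here this is seen directly: [beta = dw + v du], the pull-back of
[alpha], vanishes on the distribution; differentiating [beta(B) = 0] along
[d_theta] and using the symmetry of second derivatives shows that it vanishes on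
[ker alpha], and differentiating once more that [du /\ dv] vanishes on
[d_theta] and any contact vector.  If [(du, dv)(d_theta)] were not zero, the
differential of [f] would then have rank at most 2 on the 3-dimensional
[ker alpha].  Hence [df(d_theta)] is vertical ([derive_theta_xyz]), and [f] maps
every vertical leaf into a vertical leaf.

Along a leaf the differentials [du] and [dv] do not change either, while [B]
changes sign when [theta] grows by [2 pi].  As [t/2] is the direction of
[(du, dv)(B)], it moves by a nonzero multiple of [pi] over each period, and since
[t] is monotone on the leaf, [k] periods are stretched over an interval of
length at least [2 k pi] ([twist]).

The leaf over the (n+1)-st point has length [2 (n+1) pi + eps], which contains
exactly [n+1] full periods because [0 < eps <= 2 pi]; the leaves over other
points of R^3 are infinite.  Applied to [f] and to its inverse, the previous
estimate shows that the leaf over each [x n] is preserved ([base_fixed]).  By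
density [u, v, w] are the coordinates [x, y, z] everywhere.  Then
[(du, dv)(B) = (cos(theta/2), sin(theta/2))], so that [sin((t - theta)/2) = 0];
differentiating this, [t - theta] is constant on each leaf.  The leaf over
[x n] is a bounded interval mapped into itself by a translation, so the constant
is zero there, and by density [f] is the identity. *)

(** * Mean values along lines and symmetry of second derivatives *)

Section Calculus.
Context {R : realType}.
Implicit Types V W : normedModType R.

Lemma near_open {T : topologicalType} (U : set T) p :
  open U -> U p -> \forall q \near p, U q.
Proof. by move=> oU Up; apply: open_nbhs_nbhs. Qed.

Lemma is_derive_line {V W} (f : V -> W) (p v : V) (s : R) :
  differentiable f (p + s *: v) ->
  is_derive s 1 (fun r : R => f (p + r *: v)) ('D_v f (p + s *: v)).
Proof.
move=> df.
have E : (fun h : R => h^-1 *: (f (h *: v + (p + s *: v)) - f (p + s *: v))) =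
   (fun h : R => h^-1 *: (f (p + (h *: 1 + s) *: v) - f (p + s *: v))).
  by apply/funext => h; rewrite scalerDl addrCA -scalerA scale1r.
have := @diff_derivable _ _ _ f _ v df; rewrite /derivable E => D.
by split; rewrite /derive ?E.
Qed.

(** This is used both for second differences and to show that a function with
zero derivative along the leaves is constant on them. *)
Lemma mean_value_line {V} (f : V -> R) (p v : V) (s : R) : 0 < s ->
  (forall r, 0 <= r <= s -> differentiable f (p + r *: v)) ->
  exists2 r, 0 <= r <= s & f (p + s *: v) - f p = 'D_v f (p + r *: v) * s.
Proof.
move=> s0 df.
have D r : 0 <= r <= s ->
  is_derive r 1 (fun r : R => f (p + r *: v)) ('D_v f (p + r *: v)).
  by move=> /df; exact: is_derive_line.
have [||r] := @MVT R (fun r : R => f (p + r *: v))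
    (fun r => 'D_v f (p + r *: v)) 0 s s0.
- by move=> r; rewrite in_itv /= => /andP[r0 rs]; apply: D; rewrite !ltW.
- apply: derivable_within_continuous => r; rewrite in_itv /= => /D rD.
  exact: ex_derive.
rewrite in_itv /= scale0r addr0 subr0 => /andP[r0 rs] E.
by exists r => //; rewrite !ltW.
Qed.

Lemma is_derive_comp1 {V} (u : V -> R) (g : R -> R) (p v : V) (dg : R) :
  differentiable u p -> is_derive (u p) 1 g dg ->
  is_derive p v (g \o u) (dg * 'D_v u p).
Proof.
move=> du gD.
have dg' : differentiable g (u p) by apply/derivable1_diffP; case: gD.
have dc : differentiable (g \o u) p by apply: differentiable_comp.
split; first exact: diff_derivable.
rewrite deriveE// diff_comp//= deriveE//.
rewrite deriv1E; last by case: gD.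
by rewrite derive1E (@derive_val _ _ _ _ _ _ _ gD) [LHS]mulrC.
Qed.

Lemma differentiable_comp1 {V} (u : V -> R) (g : R -> R) (p : V) (dg : R) :
  differentiable u p -> is_derive (u p) 1 g dg -> differentiable (g \o u) p.
Proof.
move=> du gD; apply: differentiable_comp => //.
by apply/derivable1_diffP; case: gD.
Qed.

Lemma derive_translate {V W} (f : V -> W) (p v c : V) :
  'D_v (fun q => f (q + c)) p = 'D_v f (p + c).
Proof.
have E : (fun k : R => k^-1 *: (f (k *: v + p + c) - f (p + c))) =
   (fun k : R => k^-1 *: (f (k *: v + (p + c)) - f (p + c))).
  by apply/funext => k; rewrite addrA.
by rewrite /derive -E.
Qed.

Lemma near_close2 {V} (U : set V) (F G : V -> R) (p : V) (e : R) : 0 < e ->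
  (\forall q \near p, U q) -> {for p, continuous F} -> {for p, continuous G} ->
  \forall q \near p, [/\ U q, `|F p - F q| < e & `|G p - G q| < e].
Proof.
move=> e0 NU /cvgrPdist_lt/(_ _ e0) NF /cvgrPdist_lt/(_ _ e0) NG.
by near=> q; split; near: q.
Unshelve. all: by end_near.
Qed.

Lemma near_parallelogram {V} (P : set V) (p v w : V) :
  (\forall q \near p, P q) -> exists2 s : R, 0 < s & forall r r',
    0 <= r <= s -> 0 <= r' <= s -> P (p + r *: v + r' *: w).
Proof.
move=> /nbhs_ballP[e /= e0 eP].
have m0 : 0 < `|v| + `|w| + 1 by rewrite ltr_pwDr// addr_ge0.
(* The term 1 avoids a division by zero when [v] and [w] vanish. *)
exists (e / 2 / (`|v| + `|w| + 1)); first by rewrite !divr_gt0.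
set s := e / 2 / _ => r r' /andP[r0 rs] /andP[r0' rs'].
apply: eP; rewrite -ball_normE /= -addrA opprD addrA subrr sub0r normrN.
apply: (le_lt_trans (ler_normD _ _)); rewrite !normrZ !ger0_norm//.
apply: (@le_lt_trans _ _ (s * (`|v| + `|w| + 1))).
  rewrite !mulrDr mulr1 -[leLHS]addr0 !lerD// ?ler_wpM2r//.
  by rewrite (le_trans r0).
by rewrite /s divfK ?gt_eqF// ltr_pdivrMr// ltr_pMr// ltr1n.
Qed.

Section Schwarz.
Context {V : normedModType R} (h : V -> R) (U : set V).
Hypothesis oU : open U.

(** Two applications of the mean value theorem, first to the difference of
translates along [v] and then along [w]. The left-hand side is symmetric in [v]
and [w], which is what makes the derivatives commute. *)
Lemma second_difference (p v w : V) (s : R) : 0 < s ->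
  (forall r r', 0 <= r <= s -> 0 <= r' <= s ->
     differentiable h (p + r *: v + r' *: w) /\
     differentiable ('D_v h) (p + r *: v + r' *: w)) ->
  exists r r', [/\ 0 <= r <= s, 0 <= r' <= s &
    h (p + s *: v + s *: w) - h (p + s *: v) - h (p + s *: w) + h p =
    'D_w ('D_v h) (p + r *: v + r' *: w) * (s * s)].
Proof.
move=> s0 dh.
have s00 : (0 <= (0:R) <= s) by rewrite lexx ltW.
have ss0 : (0 <= s <= s) by rewrite lexx ltW.
pose g q := h (q + s *: w) - h q.
have dsh q : differentiable h (q + s *: w) ->
    differentiable (fun q => h (q + s *: w)) q.
  move=> d; apply: (@differentiable_comp _ _ _ _ (fun q => q + s *: w) h) => //.
have dg r : 0 <= r <= s -> differentiable g (p + r *: v).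
  move=> rs; apply: differentiableB.
    apply: dsh; exact: (dh _ _ rs ss0).1.
  have := (dh _ _ rs s00).1; by rewrite scale0r addr0.
have [r rs] := mean_value_line s0 dg.
have Dg : 'D_v g (p + r *: v) =
   'D_v h (p + r *: v + s *: w) - 'D_v h (p + r *: v).
  have d1 := dsh _ (dh _ _ rs ss0).1.
  have d2 : differentiable h (p + r *: v).
    have := (dh _ _ rs s00).1; by rewrite scale0r addr0.
  rewrite /g deriveB; [|exact: (@diff_derivable _ _ _ _ _ v d1)|
                        exact: (@diff_derivable _ _ _ _ _ v d2)].
  by rewrite derive_translate.
have [r' rs' E] := @mean_value_line V ('D_v h) (p + r *: v) w s s0
   (fun r' h' => (dh _ _ rs h').2).
rewrite Dg E -mulrA => F; exists r, r'; split => //.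
by rewrite -F /g [p + s *: v + _]addrC opprB addrA addrAC; ring.
Qed.

(** Both mixed derivatives are limits of the same second difference divided by
[s * s]; if they differed, continuity would keep them apart on a small
parallelogram. *)
Lemma derive_commute (p v w : V) : class_C 2 U h -> U p ->
  'D_w ('D_v h) p = 'D_v ('D_w h) p.
Proof.
move=> [dh hC] Up; have [dv vC] := hC v; have [dw wC] := hC w.
have Cvw : {for p, continuous ('D_w ('D_v h))} by exact: vC.
have Cwv : {for p, continuous ('D_v ('D_w h))} by exact: wC.
apply/eqP/negPn/negP => ne.
set a := 'D_w _ p in ne; set b := 'D_v _ p in ne.
pose e := `|a - b| / 2.
have e0 : 0 < e by rewrite divr_gt0// normr_gt0 subr_eq0.
have [s s0 N] : exists2 s : R, 0 < s & forall r r',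
    0 <= r <= s -> 0 <= r' <= s -> [/\ U (p + r *: v + r' *: w),
     `|a - 'D_w ('D_v h) (p + r *: v + r' *: w)| < e &
     `|b - 'D_v ('D_w h) (p + r *: v + r' *: w)| < e].
  apply: (@near_parallelogram _ (fun q => [/\ U q, `|a - 'D_w ('D_v h) q| < e
    & `|b - 'D_v ('D_w h) q| < e])).
  exact: (near_close2 e0 (near_open oU Up) Cvw Cwv).
have [|r [r' [rs rs' E1]]] := @second_difference p v w s s0.
  move=> r r' rs rs'; have [Uq _ _] := N _ _ rs rs'.
  by split; [apply: dh|apply: dv].
have [|k [k' [ks ks' E2]]] := @second_difference p w v s s0.
  move=> m m' ms ms'; have [Uq _ _] := N _ _ ms' ms.
  by rewrite addrAC; split; [apply: dh|apply: dw].
have [_ HA _] := N _ _ rs rs'.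
have [_ _ HB] := N _ _ ks' ks.
rewrite [p + s *: w + _]addrAC [p + k *: w + _]addrAC in E2.
have EAB : 'D_w ('D_v h) (p + r *: v + r' *: w) =
           'D_v ('D_w h) (p + k' *: v + k *: w).
  have ss : s * s != 0 by rewrite mulf_neq0// gt_eqF.
  apply: (mulIf ss); apply: (etrans (esym E1)); apply: (etrans _ E2).
  by rewrite [X in X + h p]addrAC.
rewrite EAB in HA; rewrite distrC in HB.
have := le_lt_trans (ler_distD _ _ _) (ltrD HA HB).
by rewrite /e -splitr ltxx.
Qed.
End Schwarz.
End Calculus.

(** * Functions of class C^k on an open set *)

Section Smoothness.
Context {R : realType}.
Implicit Types V W : normedModType R.

(** The remainder of the first-order expansion only depends on the germ. *)
Lemma near_eq_differentiable {V W} (f g : V -> W) (x : V) :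
  (\forall y \near x, f y = g y) -> differentiable f x -> differentiable g x.
Proof.
move=> fg df; have [dfc fE] := (diff_locallyP x f).1 df.
have gE : g \o shift x = cst (g x) + 'd f x +o_ 0 id.
  apply/eqaddoE/eqaddoP => _/posnumP[e].
  have N : \forall h \near (0 : V),
      `|f (h + x) - (f x + 'd f x h)| <= e%:num * `|h|.
    exact: (eqadd_some_oP fE (gt0 e)).
  have fgs : \forall h \near 0, f (h + x) = g (h + x).
    by move: fg; rewrite (near_shift 0) /=; apply: filterS => h; rewrite /= subr0.
  suff : \forall h \near (0 : V),
      `|g (h + x) - (g x + 'd f x h)| <= e%:num * `|h| by [].
  by apply: filterS (filterI N fgs) => h [+ fh]; rewrite fh (nbhs_singleton fg).
apply/diff_locallyP; have E := diff_unique dfc gE.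
by rewrite E.
Qed.

(** Being of class C^k on an open set only depends on the values there, so
derivatives may be computed by formulas that hold only on the set. *)
Lemma class_C_eq {V W} (U : set V) (k : nat) (f g : V -> W) : open U ->
  (forall p, U p -> f p = g p) -> class_C k U f -> class_C k U g.
Proof.
move=> oU; elim: k f g => [|k IH] f g fg /=.
  move=> fc p Up; rewrite /prop_for /continuous_at -(fg _ Up).
  apply: cvg_trans (fc p Up); apply: near_eq_cvg.
  by apply: filterS (near_open oU Up) => q /fg.
move=> [df dC]; split=> [p Up|v].
  apply: near_eq_differentiable (df p Up).
  by apply: filterS (near_open oU Up) => q /fg.
apply: IH (dC v) => p Up; apply: near_eq_derive.
by apply: filterS (near_open oU Up) => q /fg.
Qed.

Lemma class_CW {V W} (U : set V) (k : nat) (f : V -> W) :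
  class_C k.+1 U f -> class_C k U f.
Proof.
elim: k f => [|k IH] f /=.
  by move=> [df _] p Up; exact/differentiable_continuous/df.
by move=> [df dC]; split => // v; apply: IH; exact: dC.
Qed.

Lemma class_C_cst {V W} (U : set V) (k : nat) (c : W) :
  class_C k U (fun _ : V => c).
Proof.
elim: k c => [|k IH] c /=; first by move=> p _; exact: cst_continuous.
split => [p _|v]; first exact: differentiable_cst.
rewrite (_ : 'D_v _ = fun _ => 0); first exact: IH.
by apply/funext => p; exact: derive_cst.
Qed.

Lemma class_CD {V W} (U : set V) (k : nat) (f g : V -> W) : open U ->
  class_C k U f -> class_C k U g -> class_C k U (fun p => f p + g p).
Proof.
move=> oU; elim: k f g => [|k IH] f g /=.
  by move=> fc gc p Up; apply: continuousD; [exact: fc|exact: gc].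
move=> [df dCf] [dg dCg]; split => [p Up|v].
  by apply: differentiableD; [exact: df|exact: dg].
apply: class_C_eq (IH _ _ (dCf v) (dCg v)) => // p Up.
by rewrite deriveD//; apply: diff_derivable; [exact: df|exact: dg].
Qed.

Lemma class_CM {V} (U : set V) (k : nat) (a b : V -> R) : open U ->
  class_C k U a -> class_C k U b -> class_C k U (fun p => a p * b p).
Proof.
move=> oU; elim: k a b => [|k IH] a b.
  by move=> ac bc p Up; apply: continuousM; [exact: ac|exact: bc].
move=> aC bC; have [da dCa] := aC; have [db dCb] := bC; split => [p Up|v].
  by apply: differentiableM; [exact: da|exact: db].
apply: class_C_eq (class_CD oU (IH _ _ (class_CW aC) (dCb v))
                               (IH _ _ (class_CW bC) (dCa v))) => // p Up.
by rewrite deriveM//; apply: diff_derivable; [exact: da|exact: db].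
Qed.

Lemma class_CZl {V W} (U : set V) (k : nat) (a : V -> R) (c : W) : open U ->
  class_C k U a -> class_C k U (fun p => a p *: c).
Proof.
move=> oU; elim: k a => [|k IH] a.
  move=> ac p Up; apply: (@continuous_comp _ _ _ a ( *:%R^~ c)); first exact: ac.
  exact: scalel_continuous.
move=> [da dCa]; split => [p Up|v].
  by apply: differentiableZl; exact: da.
apply: class_C_eq (IH _ (dCa v)) => // p Up.
have dap := da p Up.
by rewrite [RHS]deriveE ?diffZl -?deriveE//; exact: differentiableZl.
Qed.

(** Cosine and sine are treated together because each is, up to sign, the
derivative of the other. *)
Lemma class_C_cos_sin {V} (U : set V) (k : nat) (l : V -> R) : open U ->
  (forall k, class_C k U l) ->
  class_C k U (cos \o l) /\ class_C k U (sin \o l).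
Proof.
move=> oU lC; elim: k => [|k [IHc IHs]].
  have lc p : U p -> {for p, continuous l} := lC 0 p.
  split=> p Up; apply: continuous_comp (lc p Up) _.
    exact: continuous_cos.
  exact: continuous_sin.
have [dl dlC] := lC k.+1.
split; (split => [p Up|v]).
- exact: differentiable_comp1 (dl p Up) (is_derive_cos _).
- apply: (@class_C_eq _ _ _ _ (fun p => (sin \o l) p * (- 1 * 'D_v l p))) => //.
    move=> p Up; have D := is_derive_comp1 v (dl p Up) (is_derive_cos _).
    rewrite (@derive_val _ _ _ _ _ _ _ D).
    by rewrite mulN1r mulrN mulNr.
  apply: class_CM => //; apply: (@class_CM _ _ _ (fun=> -1)) => //.
    exact: class_C_cst.
  exact: dlC.
- exact: differentiable_comp1 (dl p Up) (is_derive_sin _).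
- apply: (@class_C_eq _ _ _ _ (fun p => (cos \o l) p * ('D_v l p))) => //.
    move=> p Up; have D := is_derive_comp1 v (dl p Up) (is_derive_sin _).
    by rewrite (@derive_val _ _ _ _ _ _ _ D).
  by apply: class_CM => //; exact: dlC.
Qed.

Section Coord.
Context {V : normedModType R} {m n : nat} (M : V -> 'M[R]_(m, n)) (i : 'I_m) (j : 'I_n).

Lemma differentiable_entry p : differentiable M p ->
  differentiable (fun q => M q i j) p.
Proof.
move=> dM; apply: (@differentiable_comp _ _ _ _ M (fun N : 'M[R]_(m, n) => N i j)) => //.
exact: differentiable_coord.
Qed.

Lemma derive_entry p v : derivable M p v ->
  'D_v (fun q => M q i j) p = ('D_v M p) i j.
Proof. by move=> dM; rewrite derive_mx// mxE. Qed.

End Coord.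

Lemma class_C_entry {V} {m n : nat} (U : set V) (k : nat)
  (M : V -> 'M[R]_(m, n)) i j : open U ->
  class_C k U M -> class_C k U (fun q => M q i j).
Proof.
move=> oU; elim: k M => [|k IH] M.
  move=> cM p Up; apply: (@continuous_comp _ _ _ M (fun N : 'M[R]_(m, n) => N i j)).
    exact: cM.
  exact: coord_continuous.
move=> [dM CM]; split => [p Up|v].
  exact/differentiable_entry/dM.
apply: class_C_eq (IH _ (CM v)) => // p Up.
by rewrite derive_entry//; apply: diff_derivable; exact: dM.
Qed.

Lemma class_C_id {V} (U : set V) (k : nat) : class_C k U (@id V).
Proof.
case: k => [|k]; first by move=> p _.
split => [p _|v]; first exact: ex_diff.
rewrite (_ : 'D_v _ = fun _ => v); first exact: class_C_cst.
by apply/funext => p; exact: derive_id.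
Qed.

End Smoothness.

Section MatrixSmooth.
Context {R : realType} {V : normedModType R}.

Lemma class_C_sum {W : normedModType R} (U : set V) (k : nat) (I : Type) (r : seq I)
    (F : I -> V -> W) : open U ->
  (forall i, class_C k U (F i)) -> class_C k U (fun p => \sum_(i <- r) F i p).
Proof.
move=> oU FC; elim: r => [|i r IH].
  apply: class_C_eq (@class_C_cst _ _ _ U k 0) => // p _; by rewrite big_nil.
apply: class_C_eq (class_CD oU (FC i) IH) => // p _; by rewrite big_cons.
Qed.

Lemma derive_add_mul (a y b : V -> R) p h : derivable a p h -> derivable y p h ->
  derivable b p h -> 'D_h (fun q => a q + y q * b q) p =
  'D_h a p + (y p * 'D_h b p + b p * 'D_h y p).
Proof.
move=> da dy db; rewrite (_ : (fun q => _) = a + y * b)//.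
apply: (etrans (deriveD da (derivableM dy db))).
rewrite (deriveM dy db).
by move: ('D_h a p) ('D_h b p) ('D_h y p) => da' db' dy'.
Qed.

Lemma differentiable_add_mul (a y b : V -> R) p : differentiable a p ->
  differentiable y p -> differentiable b p ->
  differentiable (fun q => a q + y q * b q) p.
Proof.
by move=> da dy db; exact: (differentiableD da (differentiableM dy db)).
Qed.

(** Smoothness of matrix-valued maps is checked entrywise, by expanding in the
standard basis. *)
Lemma class_C_mx {m n : nat} (U : set V) (k : nat) (M : V -> 'M[R]_(m, n)) :
  open U -> (forall i j, class_C k U (fun p => M p i j)) -> class_C k U M.
Proof.
move=> oU MC.
apply: (@class_C_eq _ _ _ _ _
  (fun p => \sum_i \sum_j M p i j *: (delta_mx i j : 'M[R]_(m, n)))) => //.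
  by move=> p _; rewrite -matrix_sum_delta.
apply: class_C_sum => // i; apply: class_C_sum => // j.
exact: class_CZl.
Qed.

End MatrixSmooth.

(** * The contact distribution and the Engel distribution *)

Section StandardEngel.
Context {R : realType}.
Local Notation R4 := 'rV[R]_4.

Lemma rv4P (v w : R4) : v 0 0 = w 0 0 -> v 0 1 = w 0 1 -> v 0 2 = w 0 2 ->
  v 0 3 = w 0 3 -> v = w.
Proof.
move=> h0 h1 h2 h3; apply/rowP => -[[|[|[|[|]]]]//= i].
- by rewrite (_ : Ordinal i = 0)//; apply/val_inj.
- by rewrite (_ : Ordinal i = 1)//; apply/val_inj.
- by rewrite (_ : Ordinal i = 2)//; apply/val_inj.
- by rewrite (_ : Ordinal i = 3)//; apply/val_inj.
Qed.

(** A plane vector orthogonal to [(s, -c)] is a multiple of the unit vector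
[(c, s)]. *)
Lemma unit_parallel (F : realFieldType) (c s a b : F) : c ^+ 2 + s ^+ 2 = 1 ->
  s * a = c * b -> a = (c * a + s * b) * c /\ b = (c * a + s * b) * s.
Proof.
move=> cs h; split.
- by transitivity ((c ^+ 2 + s ^+ 2) * a); [rewrite cs mul1r|ring: h].
- by transitivity ((c ^+ 2 + s ^+ 2) * b); [rewrite cs mul1r|ring: h].
Qed.

(** The kernel of the contact form [dz + y dx] on R^3, pulled back to R^4. *)
Definition contact (p v : R4) : Prop := v 0 2 + p 0 1 * v 0 0 = 0.
Definition frame_B (p : R4) : R4 :=
  cos (coord_theta p / 2) *: field_X p + sin (coord_theta p / 2) *: field_Y p.

(** The dual description of the distribution by two linear equations is the one
that can be differentiated. *)
Lemma dist_DP (p v : R4) : dist_D p v <->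
  contact p v /\ sin (p 0 3 / 2) * v 0 0 = cos (p 0 3 / 2) * v 0 1.
Proof.
rewrite /contact; split.
  move=> [a [b ->]]; rewrite !mxE /= /coord_theta /coord_y; split; ring.
move=> [h1 h2]; exists (v 0 3), (cos (p 0 3 / 2) * v 0 0 + sin (p 0 3 / 2) * v 0 1).
have [e0 e1] := unit_parallel (cos2Dsin2 (p 0 3 / 2)) h2.
apply: rv4P; rewrite !mxE /= /coord_theta /coord_y.
- by rewrite [LHS]e0; ring.
- by rewrite [LHS]e1; ring.
- by transitivity (- (p 0 1 * v 0 0)); [lra|rewrite {1}e0; ring].
- by ring.
Qed.

Lemma parallel_D (p v : R4) : dist_D p v -> exists k,
  v 0 0 = k * cos (p 0 3 / 2) /\ v 0 1 = k * sin (p 0 3 / 2).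
Proof.
by move=> /dist_DP[_ /unit_parallel-/(_ (cos2Dsin2 _))[? ?]]; eexists; split; eassumption.
Qed.

Lemma class_C_coord (U : set R4) k i : open U ->
  class_C k U (fun p : R4 => p 0 i).
Proof.
move=> oU; apply: (@class_C_entry _ _ _ _ U k id 0 i) => //.
exact: class_C_id.
Qed.

Lemma class_C_half (U : set R4) k : open U ->
  class_C k U (fun p : R4 => p 0 3 / 2).
Proof.
by move=> oU; apply: class_CM => //; [exact: class_C_coord|exact: class_C_cst].
Qed.

Lemma class_C_frame_B (U : set R4) k : open U -> class_C k U frame_B.
Proof.
move=> oU.
have [Cc Cs] := class_C_cos_sin k oU (fun k => class_C_half k oU).
apply: (@class_C_eq _ _ _ _ _ (fun p : R4 =>
   cos (p 0 3 / 2) *: d_x + ((p 0 1 * (-1 * cos (p 0 3 / 2))) *: d_z +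
   sin (p 0 3 / 2) *: d_y))) => //.
  move=> p _; rewrite /frame_B /field_X /field_Y /coord_theta /coord_y.
  by rewrite scalerBr scalerA -addrA -scaleNr; congr (_ + (_ *: _ + _)); ring.
apply: class_CD => //; first exact: class_CZl.
apply: class_CD => //; last exact: class_CZl.
apply: class_CZl => //; apply: class_CM => //; first exact: class_C_coord.
by apply: class_CM => //; exact: class_C_cst.
Qed.

Lemma class_C_field_X (U : set R4) k : open U -> class_C k U (@field_X R).
Proof.
move=> oU; apply: (@class_C_eq _ _ _ _ _ (fun p : R4 =>
   d_x + (p 0 1 * -1) *: d_z)) => //.
  by move=> p _; rewrite /field_X /coord_y mulrN1 scaleNr.
apply: class_CD => //; first exact: class_C_cst.
apply: class_CZl => //; apply: class_CM => //; [exact: class_C_coord|exact: class_C_cst].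
Qed.

Lemma derive_coord (p h : R4) i : 'D_h (fun q : R4 => q 0 i) p = h 0 i.
Proof.
rewrite (@derive_entry _ _ _ _ id)//.
by rewrite derive_id.
Qed.

Lemma lspan2 (A : set R4) (w1 w2 : R4) c : A w1 -> A w2 -> lspan A (w1 + c *: w2).
Proof.
move=> A1 A2; exists 2, (fun i => if i == 0 then 1 else c),
  (fun i => if i == 0 then w1 else w2); split; first by move=> i; case: ifP.
by rewrite !big_ord_recl big_ord0 /= scale1r addr0.
Qed.

Lemma contact_lspan (A : set R4) p : (forall v, A v -> contact p v) ->
  forall v, lspan A v -> contact p v.
Proof.
move=> Ac v [n [a [w [Aw ->]]]]; rewrite /contact !summxE mulr_sumr -big_split /=.
apply: big1 => i _; rewrite !mxE; have := Ac _ (Aw i); rewrite /contact => h.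
by rewrite mulrCA -mulrDr h mulr0.
Qed.

(** The derivative of the identity [alpha (S q) = 0]; the last term comes from the
coefficient [y] of [alpha]. *)
Lemma derive_contact (O : set R4) (S : R4 -> R4) p h : open O -> O p ->
  smooth_on O S -> (forall q, O q -> contact q (S q)) ->
  ('D_h S p) 0 2 + p 0 1 * ('D_h S p) 0 0 + S p 0 0 * h 0 1 = 0.
Proof.
move=> oO Op /(_ 1%N)[dS _] cS.
have dp : derivable S p h by apply: diff_derivable; exact: dS.
have di i : derivable (fun q => S q 0 i) p h.
  by apply/diff_derivable/differentiable_entry/dS.
have dy : derivable (fun q : R4 => q 0 1) p h.
  apply/diff_derivable; exact: differentiable_coord.
have := @near_eq_derive _ _ _ (fun q => S q 0 2 + q 0 1 * S q 0 0) (cst 0) p h.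
rewrite derive_cst => <-; last first.
  by apply: filterS (near_open oO Op) => q /cS.
rewrite (derive_add_mul (di 2) dy (di 0)) derive_coord.
rewrite (derive_entry 0 2 dp) (derive_entry 0 0 dp).
by rewrite addrA.
Qed.

(** Evaluating [alpha] on the bracket leaves only the area of the projections of
[S p] and [T p] to the [(x, y)]-plane, and these are parallel because both are
multiples of [(cos(theta/2), sin(theta/2))]. *)
Lemma contact_bracket (O : set R4) (S T : R4 -> R4) p : open O -> O p ->
  local_section O dist_D S -> local_section O dist_D T ->
  contact p (lie_bracket S T p).
Proof.
move=> oO Op [sS hS] [sT hT].
have cS q : O q -> contact q (S q) by move=> /hS/dist_DP[].
have cT q : O q -> contact q (T q) by move=> /hT/dist_DP[].
have := derive_contact (T p) oO Op sS cS.
have := derive_contact (S p) oO Op sT cT.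
rewrite /contact /lie_bracket !mxE.
move: ('D_ _ _ _) ('D_ _ _ _) => a b.
have [k [-> ->]] := parallel_D (hS _ Op).
have [m [-> ->]] := parallel_D (hT _ Op).
move: (cos _) (sin _) => c s ha hb; lra.
Qed.

Lemma local_section_comb (O : set R4) (a b : R) : open O ->
  local_section O dist_D (fun q => a *: d_theta + b *: frame_B q).
Proof.
move=> oO; split=> [k|q _]; last by exists a, b.
apply: class_CD => //; first exact: class_C_cst.
apply: class_C_mx => // i j.
apply: (@class_C_eq _ _ _ _ _ (fun p => b * frame_B p i j)) => //.
  by move=> p _; rewrite [RHS]mxE.
apply: class_CM => //; first exact: class_C_cst.
by apply: class_C_entry => //; exact: class_C_frame_B.
Qed.

Lemma differentiable_half (p : R4) : differentiable (fun q : R4 => q 0 3 / 2) p.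
Proof. exact: (class_C_half 1 (@openT R4)).1. Qed.

Lemma derive_theta_half (p : R4) :
  'D_d_theta (fun q : R4 => q 0 3 / 2) p = 2^-1.
Proof.
rewrite (_ : (fun q => _) = (fun q : R4 => q 0 3) * cst 2^-1)//.
rewrite deriveM//; last by apply/diff_derivable; exact: differentiable_coord.
by rewrite derive_cst scaler0 add0r derive_coord !mxE /= [LHS]mulr1.
Qed.

Lemma differentiable_cos_half (p : R4) :
  differentiable (fun q : R4 => cos (q 0 3 / 2)) p.
Proof. exact: (differentiable_comp1 (differentiable_half p) (is_derive_cos _)). Qed.

Lemma differentiable_sin_half (p : R4) :
  differentiable (fun q : R4 => sin (q 0 3 / 2)) p.
Proof. exact: (differentiable_comp1 (differentiable_half p) (is_derive_sin _)). Qed.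

Lemma derive_theta_cos_half (p : R4) :
  'D_d_theta (fun q : R4 => cos (q 0 3 / 2)) p = - sin (p 0 3 / 2) / 2.
Proof.
by rewrite (@derive_val _ _ _ _ _ _ _ (is_derive_comp1 d_theta
  (differentiable_half p) (is_derive_cos _))) derive_theta_half.
Qed.

Lemma derive_theta_sin_half (p : R4) :
  'D_d_theta (fun q : R4 => sin (q 0 3 / 2)) p = cos (p 0 3 / 2) / 2.
Proof.
by rewrite (@derive_val _ _ _ _ _ _ _ (is_derive_comp1 d_theta
  (differentiable_half p) (is_derive_sin _))) derive_theta_half.
Qed.

Lemma derive_theta_frame_B (p : R4) : 'D_d_theta frame_B p =
  2^-1 *: (cos (p 0 3 / 2) *: field_Y p - sin (p 0 3 / 2) *: field_X p).
Proof.
have oT : open [set: R4] := openT.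
have [dB _] := class_C_frame_B 1 oT.
have dBp := @diff_derivable _ _ _ _ _ d_theta (dB p I).
have Dc := derive_theta_cos_half p; have Ds := derive_theta_sin_half p.
have dc := @diff_derivable _ _ _ _ _ d_theta (differentiable_cos_half p).
have dy : derivable (fun q : R4 => q 0 1) p d_theta.
  by apply/diff_derivable; exact: differentiable_coord.
apply: rv4P.
- rewrite -(derive_entry 0 0 dBp) (_ : (fun q => frame_B q 0 0) =
    (fun q : R4 => cos (q 0 3 / 2))) ?Dc; last first.
    by apply/funext => q; rewrite !mxE /= /coord_theta; ring.
  by rewrite !mxE /=; field.
- rewrite -(derive_entry 0 1 dBp) (_ : (fun q => frame_B q 0 1) =
    (fun q : R4 => sin (q 0 3 / 2))) ?Ds; last first.
    by apply/funext => q; rewrite !mxE /= /coord_theta; ring.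
  by rewrite !mxE /=; field.
- rewrite -(derive_entry 0 2 dBp) (_ : (fun q => frame_B q 0 2) =
    (fun q : R4 => 0 + (- q 0 1) * cos (q 0 3 / 2))); last first.
    by apply/funext => q; rewrite !mxE /= /coord_theta /coord_y; ring.
  rewrite (derive_add_mul (derivable_cst _ _ _) (derivableN dy) dc).
  by rewrite derive_cst (deriveN dy) derive_coord Dc !mxE /= fctE /coord_y; field.
- rewrite -(derive_entry 0 3 dBp) (_ : (fun q => frame_B q 0 3) = cst 0) ?derive_cst;
    last first.
    by apply/funext => q; rewrite !mxE /=; ring.
  by rewrite !mxE /=; field.
Qed.

(** A contact vector is the value of a section plus a multiple of the bracket of
[d_theta] and [frame_B], whose projection to the [(x, y)]-plane is orthogonal to
that of [frame_B]. *)
Lemma derived_dist_D (U : set R4) (p : R4) : open U -> U p ->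
  derived U dist_D p = contact p.
Proof.
move=> oU Up; apply/seteqP; split.
  apply: contact_lspan => v [U' [oU' Up' sU' [[S [_ hS] ->]|[S [T [hS hT ->]]]]]].
    by have /dist_DP[] := hS p Up'.
  exact: contact_bracket oU' Up' hS hT.
move=> v cv; set c := cos (p 0 3 / 2); set s := sin (p 0 3 / 2).
have cs : c ^+ 2 + s ^+ 2 = 1 := cos2Dsin2 _.
have -> : v = (v 0 3 *: d_theta + (v 0 0 * c + v 0 1 * s) *: frame_B p) +
   (2 * (v 0 1 * c - v 0 0 * s)) *: lie_bracket (fun q => 1 *: d_theta + 0 *: frame_B q)
     (fun q => 0 *: d_theta + 1 *: frame_B q) p.
  have -> : lie_bracket (fun q => 1 *: d_theta + 0 *: frame_B q)
     (fun q => 0 *: d_theta + 1 *: frame_B q) p = 'D_d_theta frame_B p.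
    rewrite (_ : (fun q => 1 *: d_theta + 0 *: frame_B q) = cst d_theta); last first.
      by apply/funext => q; rewrite scale1r scale0r addr0.
    rewrite (_ : (fun q => 0 *: d_theta + 1 *: frame_B q) = frame_B); last first.
      by apply/funext => q; rewrite scale1r scale0r add0r.
    by rewrite /lie_bracket derive_cst subr0 /cst.
  rewrite derive_theta_frame_B -/c -/s.
  have v2 : v 0 2 = - (p 0 1 * v 0 0) by move: cv; rewrite /contact => cv; lra.
  apply: rv4P; rewrite !mxE /= /coord_theta /coord_y -/c -/s ?v2.
  - by transitivity ((c ^+ 2 + s ^+ 2) * v 0 0); [rewrite cs mul1r|field].
  - by transitivity ((c ^+ 2 + s ^+ 2) * v 0 1); [rewrite cs mul1r|field].
  - by transitivity (- (p 0 1 * ((c ^+ 2 + s ^+ 2) * v 0 0))); [rewrite cs mul1r|field].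
  - by field.
apply: lspan2; exists U; split => //; [left|right].
  by exists (fun q => v 0 3 *: d_theta + (v 0 0 * c + v 0 1 * s) *: frame_B q) => //;
    exact: local_section_comb.
by exists (fun q => 1 *: d_theta + 0 *: frame_B q),
  (fun q => 0 *: d_theta + 1 *: frame_B q); split => //; exact: local_section_comb.
Qed.

(** Only the values of the distribution on [U] matter, so this applies to the
first derived distribution. The bracket of [field_X] and [field_Y] is [d_z]. *)
Lemma derived_contact (D : R4 -> set R4) (U : set R4) (p : R4) : open U -> U p ->
  (forall q, U q -> D q = contact q) -> derived U D p = setT.
Proof.
move=> oU Up Dc; apply/seteqP; split => // v _.
pose S := fun q : R4 => v 0 3 *: d_theta + (v 0 0 *: field_X q + v 0 1 *: d_y).
have sX : local_section U D field_X.
  split=> [k|q Uq]; first exact: class_C_field_X.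
  by rewrite Dc// /contact !mxE /= /coord_y; ring.
have sY : local_section U D field_Y.
  split=> [k|q Uq]; first exact: class_C_cst.
  by rewrite Dc// /contact !mxE /=; ring.
have sS : local_section U D S.
  split=> [k|q Uq]; last by rewrite Dc// /contact !mxE /= /coord_y; ring.
  apply: class_CD => //; first exact: class_C_cst.
  apply: class_CD => //; last exact: class_C_cst.
  apply: class_C_mx => // i j.
  apply: (@class_C_eq _ _ _ _ _ (fun p => v 0 0 * field_X p i j)) => //.
    by move=> q _; rewrite [RHS]mxE.
  apply: class_CM => //; first exact: class_C_cst.
  by apply: class_C_entry => //; exact: class_C_field_X.
have -> : v = S p + (v 0 2 + p 0 1 * v 0 0) *: lie_bracket field_X field_Y p.
  have dX := @diff_derivable _ _ _ _ _ d_y ((class_C_field_X 1 oU).1 p Up).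
  have -> : lie_bracket field_X field_Y p = - 'D_d_y field_X p.
    by rewrite /lie_bracket (_ : field_Y = cst d_y)// derive_cst sub0r /cst.
  have -> : 'D_d_y field_X p = - d_z.
    apply: rv4P.
    - rewrite -(derive_entry 0 0 dX) (_ : (fun q => field_X q 0 0) = cst 1).
        by rewrite derive_cst !mxE /=; ring.
      by apply/funext => q; rewrite !mxE /=; ring.
    - rewrite -(derive_entry 0 1 dX) (_ : (fun q => field_X q 0 1) = cst 0).
        by rewrite derive_cst !mxE /=; ring.
      by apply/funext => q; rewrite !mxE /=; ring.
    - rewrite -(derive_entry 0 2 dX) (_ : (fun q => field_X q 0 2) = - (fun q : R4 => q 0 1)).
        rewrite deriveN ?derive_coord ?mxE//.
        by apply/diff_derivable; exact: differentiable_coord.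
      by apply/funext => q; rewrite !mxE /= fctE /coord_y; ring.
    - rewrite -(derive_entry 0 3 dX) (_ : (fun q => field_X q 0 3) = cst 0).
        by rewrite derive_cst !mxE /=; ring.
      by apply/funext => q; rewrite !mxE /=; ring.
  by apply: rv4P; rewrite !mxE /= /coord_y; ring.
apply: lspan2; exists U; split => //; [left|right]; first by exists S.
by exists field_X, field_Y.
Qed.

Definition frame2 (p : R4) : 'M[R]_(2, 4) :=
  \matrix_(i, j) (if i == 0 then d_theta else frame_B p) 0 j.
Definition frame3 (p : R4) : 'M[R]_(3, 4) :=
  \matrix_(i, j) (if i == 0 then d_theta else if i == 1 then field_X p else d_y) 0 j.

Lemma smooth_distribution_D (U : set R4) : open U -> smooth_distribution 2 U dist_D.
Proof.
move=> oU p Up; exists U, frame2; split=> //.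
  move=> k; apply: class_C_mx => // i j.
  apply: (@class_C_eq _ _ _ _ _
    (fun p => (if i == 0 then d_theta else frame_B p) 0 j)) => //.
    by move=> q _; rewrite [RHS]mxE.
  case: (i == 0); first exact: class_C_cst.
  by apply: class_C_entry => //; exact: class_C_frame_B.
move=> q _; have E (u : 'rV[R]_2) : u *m frame2 q = u 0 0 *: d_theta + u 0 1 *: frame_B q.
  apply/rowP => j; rewrite !mxE !big_ord_recl big_ord0 addr0 !mxE /=.
  by congr (_ + u _ _ * _); apply/val_inj.
split.
  apply: inj_row_free => u; rewrite E => /rowP uF.
  have := uF 3; rewrite !mxE /= => u0.
  have := uF 0; have := uF 1; rewrite !mxE /= => u1s u1c.
  have cs := cos2Dsin2 (coord_theta q / 2).
  have u0E : u 0 0 = 0 by move: u0; lra.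
  have u1E : u 0 1 = 0.
    have e1 : u 0 1 * cos (coord_theta q / 2) = 0 by move: u1c; lra.
    have e2 : u 0 1 * sin (coord_theta q / 2) = 0 by move: u1s; lra.
    by rewrite -[LHS]mulr1 -cs mulrDr !expr2 !mulrA e1 e2 !mul0r addr0.
  apply/rowP => -[[|[|]]//= i]; rewrite mxE.
    by rewrite (_ : Ordinal i = 0)//; exact/val_inj.
  by rewrite (_ : Ordinal i = 1)//; exact/val_inj.
apply/seteqP; split => v /=.
  move=> [a [b ->]]; apply/submxP; exists (\row_(i < 2) if i == 0 then a else b).
  by rewrite E !mxE.
by move=> /submxP[u ->]; rewrite E; exists (u 0 0), (u 0 1).
Qed.

Lemma smooth_distribution_contact (U : set R4) (D : R4 -> set R4) : open U ->
  (forall q, U q -> D q = contact q) -> smooth_distribution 3 U D.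
Proof.
move=> oU Dc p Up; exists U, frame3; split=> //.
  move=> k; apply: class_C_mx => // i j.
  apply: (@class_C_eq _ _ _ _ _ (fun p => (if i == 0 then d_theta else
      if i == 1 then field_X p else d_y) 0 j)) => //.
    by move=> q _; rewrite [RHS]mxE.
  case: (i == 0); first exact: class_C_cst.
  case: (i == 1); last exact: class_C_cst.
  by apply: class_C_entry => //; exact: class_C_field_X.
move=> q Uq; have E (u : 'rV[R]_3) : u *m frame3 q =
    u 0 0 *: d_theta + (u 0 1 *: field_X q + u 0 2 *: d_y).
  apply/rowP => j; rewrite !mxE !big_ord_recl big_ord0 addr0 !mxE /=.
  by congr (_ + (u _ _ * _ + u _ _ * _)); apply/val_inj.
split.
  apply: inj_row_free => u; rewrite E => /rowP uF.
  have := uF 3; rewrite !mxE /= => u0.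
  have := uF 0; have := uF 1; rewrite !mxE /= => u2 u1.
  apply/rowP => -[[|[|[|]]]//= i]; rewrite mxE.
  - by rewrite (_ : Ordinal i = 0); [move: u0; lra|exact/val_inj].
  - by rewrite (_ : Ordinal i = 1); [move: u1; lra|exact/val_inj].
  - by rewrite (_ : Ordinal i = 2); [move: u2; lra|exact/val_inj].
rewrite Dc//; apply/seteqP; split => v /=.
  rewrite /contact => cv; apply/submxP.
  exists (\row_(i < 3) if i == 0 then v 0 3 else if i == 1 then v 0 0 else v 0 1).
  by rewrite E; apply: rv4P; rewrite !mxE /= /coord_y; lra.
by move=> /submxP[u ->]; rewrite E /contact !mxE /= /coord_y; ring.
Qed.

Lemma smooth_distribution_full (U : set R4) (D : R4 -> set R4) : open U ->
  (forall q, U q -> D q = setT) -> smooth_distribution 4 U D.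
Proof.
move=> oU DT p Up; exists U, (fun=> 1%:M); split=> //.
  by move=> k; exact: class_C_cst.
move=> q Uq; split; first by rewrite row_free_unit unitmx1.
by rewrite DT//; apply/seteqP; split=> // v _ /=; exact: submx1.
Qed.

Lemma engel_manifold_D (U : set R4) : open U -> engel_manifold U dist_D.
Proof.
move=> oU; have D2 q : U q -> derived U dist_D q = contact q.
  by move=> Uq; exact: derived_dist_D.
split=> //; first exact: smooth_distribution_D.
  exact: smooth_distribution_contact.
by apply: smooth_distribution_full => // q Uq; exact: derived_contact.
Qed.

End StandardEngel.

(** * The vertical direction is preserved *)

(** The indices of the coordinates are named so that they can be made opaque:
otherwise unification compares [0] and [2] by computing in the ring ['I_4]. *)
Definition ix : 'I_4 := 0.
Definition iy : 'I_4 := 1.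
Definition iz : 'I_4 := 2.
Definition ith : 'I_4 := 3.

Lemma entry_d_theta_y {R : realType} : (@d_theta R) 0 1 = 0.
Proof. by rewrite mxE. Qed.

Section EngelMaps.
Context {R : realType}.
Local Notation R4 := 'rV[R]_4.

Lemma derive_basis {W : normedModType R} (f : R4 -> W) (p h : R4) :
  differentiable f p ->
  'D_h f p = h 0 0 *: 'D_d_x f p + h 0 1 *: 'D_d_y f p + h 0 2 *: 'D_d_z f p +
             h 0 3 *: 'D_d_theta f p.
Proof.
move=> df; rewrite !deriveE//.
have {1}-> : h = h 0 0 *: d_x + h 0 1 *: d_y + h 0 2 *: d_z + h 0 3 *: d_theta.
  by apply: rv4P; rewrite !mxE /=; ring.
by rewrite !linearD !linearZ.
Qed.

Lemma derive_dirD {V W : normedModType R} (f : V -> W) (p v w : V) (a b : R) :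
  differentiable f p ->
  'D_(a *: v + b *: w) f p = a *: 'D_v f p + b *: 'D_w f p.
Proof. by move=> df; rewrite !deriveE// linearP linearZ. Qed.

Lemma derivable_theta (f : R4 -> R) p : differentiable f p -> derivable f p d_theta.
Proof. exact: diff_derivable. Qed.

(** If [(u, v)] and [(a, b)] are parallel, removing from [(u, v)] its component
along [(a, b)] leaves zero. The third identity is the consequence for the [z]
component, which is [- y] times the first one on the kernel of the pulled-back
contact form. *)
Lemma project_parallel (u v a b y : R) : u * b - a * v = 0 ->
  [/\ (a ^+ 2 + b ^+ 2) * u - (u * a + v * b) * a = 0,
      (a ^+ 2 + b ^+ 2) * v - (u * a + v * b) * b = 0 &
      (a ^+ 2 + b ^+ 2) * - (y * u) - (u * a + v * b) * - (y * a) = 0].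
Proof.
move=> w; split.
- by transitivity (b * (u * b - a * v)); [ring|rewrite w mulr0].
- by transitivity (- a * (u * b - a * v)); [ring|rewrite w mulr0].
- by transitivity (- y * b * (u * b - a * v)); [ring|rewrite w mulr0].
Qed.

Lemma entry_comb (a b : R) (v w : R4) i :
  (a *: v + b *: w) 0 i = a * v 0 i + b * w 0 i.
Proof. by rewrite !mxE. Qed.

Lemma comb_eq0 (a b v w : R) : v = 0 -> w = 0 -> a *: v + b *: w = 0.
Proof. by move=> -> ->; rewrite !scaler0 addr0. Qed.

(** The properties of an automorphism that are used one map at a time; they hold
for the inverse as well, by [engel_map_inverse]. *)
Record engel_map (E : set R4) (A : R4 -> R4) : Prop := EngelMap {
  em_smooth : smooth_on E A;
  em_stable : forall p, E p -> E (A p);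
  em_inj : forall p q, E p -> E q -> A p = A q -> p = q;
  em_immersion : forall p v, E p -> 'D_v A p = 0 -> v = 0;
  em_preserve : forall p v, E p -> dist_D p v -> dist_D (A p) ('D_v A p) }.

Section OneMap.
Context (E : set R4) (A : R4 -> R4).
Hypotheses (oE : open E) (mA : engel_map E A).

Definition component (i : 'I_4) (q : R4) : R := A q 0 i.

Lemma em_diff p : E p -> differentiable A p.
Proof. by move=> Ep; have [dA _] := em_smooth mA 1; exact: dA. Qed.

Lemma component_smooth i k : class_C k E (component i).
Proof. by apply: class_C_entry => //; exact: em_smooth. Qed.

Lemma component_diff i p : E p -> differentiable (component i) p.
Proof. by move=> Ep; have [d _] := component_smooth i 1; exact: d. Qed.

Lemma derive_component_diff i h p : E p -> differentiable ('D_h (component i)) p.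
Proof. by move=> Ep; have [_ /(_ h)[d _]] := component_smooth i 2; exact: d. Qed.

Lemma derive_componentE i h p : E p -> ('D_h A p) 0 i = 'D_h (component i) p.
Proof.
by move=> Ep; rewrite derive_entry//; apply: diff_derivable; exact: em_diff.
Qed.

Lemma component_commute i h k p : E p ->
  'D_k ('D_h (component i)) p = 'D_h ('D_k (component i)) p.
Proof. by move=> Ep; exact: (derive_commute oE h k (component_smooth i 2) Ep). Qed.

Lemma component_basis i p h : E p -> 'D_h (component i) p =
  h 0 0 * 'D_d_x (component i) p + h 0 1 * 'D_d_y (component i) p +
  h 0 2 * 'D_d_z (component i) p + h 0 3 * 'D_d_theta (component i) p.
Proof. by move=> Ep; rewrite (derive_basis _ (component_diff i Ep)). Qed.

(** The pull-back of the contact form by [A], evaluated on the constant vector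
[h]. *)
Definition pull (h p : R4) : R :=
  'D_h (component iz) p + component iy p * 'D_h (component ix) p.
(** The 2-form [du /\ dv] evaluated on [h] and [d_theta], where [u] and [v] are
the [x] and [y] components of [A]. *)
Definition wedge (h p : R4) : R :=
  'D_h (component ix) p * 'D_d_theta (component iy) p -
  'D_d_theta (component ix) p * 'D_h (component iy) p.

Lemma derive_pull h k p : E p -> 'D_k (pull h) p =
  'D_k ('D_h (component iz)) p + (component iy p * 'D_k ('D_h (component ix)) p +
    'D_h (component ix) p * 'D_k (component iy) p).
Proof.
move=> Ep; apply: derive_add_mul; apply: diff_derivable.
- exact: derive_component_diff.
- exact: component_diff.
- exact: derive_component_diff.
Qed.

Lemma dist_D_theta (p : R4) : dist_D p d_theta.
Proof. by exists 1, 0; rewrite scale1r scale0r addr0. Qed.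

Lemma dist_D_frame_B (p : R4) : dist_D p (frame_B p).
Proof. by exists 0, 1; rewrite scale1r scale0r add0r. Qed.

Lemma frame_BE (p : R4) : [/\ frame_B p 0 0 = cos (p 0 3 / 2),
  frame_B p 0 1 = sin (p 0 3 / 2), frame_B p 0 2 = - (p 0 1 * cos (p 0 3 / 2)) &
  frame_B p 0 3 = 0].
Proof. by split; rewrite !mxE /= /coord_theta /coord_y; ring. Qed.

Lemma image_dist_D p v : E p -> dist_D p v ->
  'D_v (component iz) p + component iy p * 'D_v (component ix) p = 0 /\
  exists k, 'D_v (component ix) p = k * cos (component ith p / 2) /\
            'D_v (component iy) p = k * sin (component ith p / 2).
Proof.
move=> Ep Dv; have DA := em_preserve mA Ep Dv.
rewrite -!(derive_componentE _ _ Ep); split; first exact: ((dist_DP _ _).1 DA).1.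
exact: parallel_D DA.
Qed.

Lemma field_X_entries (p : R4) : [/\ field_X p 0 0 = 1,
  field_X p 0 1 = 0, field_X p 0 2 = - p 0 1 & field_X p 0 3 = 0].
Proof. by split; rewrite !mxE /= /coord_y; ring. Qed.

Lemma d_y_entries : [/\ (@d_y R) 0 0 = 0, (@d_y R) 0 1 = 1, (@d_y R) 0 2 = 0 &
  (@d_y R) 0 3 = 0].
Proof. by split; rewrite !mxE. Qed.

Lemma d_theta_entries : [/\ (@d_theta R) 0 0 = 0, (@d_theta R) 0 1 = 0,
  (@d_theta R) 0 2 = 0 & (@d_theta R) 0 3 = 1].
Proof. by split; rewrite !mxE. Qed.

Lemma derive_map_eq0 p v : E p ->
  'D_v (component ix) p = 0 -> 'D_v (component iy) p = 0 ->
  'D_v (component iz) p = 0 -> 'D_v (component ith) p = 0 -> v = 0.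
Proof.
move=> Ep; rewrite -!(derive_componentE _ _ Ep) => h0 h1 h2 h3.
by apply: (em_immersion mA Ep); apply: rv4P; rewrite mxE.
Qed.

Local Opaque ix iy iz ith d_x d_y d_z d_theta field_X frame_B.

Lemma derive_eq0 (f : R4 -> R) k p : E p -> (forall q, E q -> f q = 0) ->
  'D_k f p = 0.
Proof.
move=> Ep f0; rewrite (@near_eq_derive _ _ _ f (cst 0) p k) ?derive_cst//.
by apply: filterS (near_open oE Ep) => q /f0.
Qed.

Lemma pull_D p v : E p -> dist_D p v -> pull v p = 0.
Proof. by move=> Ep Dv; have [] := image_dist_D Ep Dv. Qed.

(** Both vectors are mapped into the distribution, where [(du, dv)] is confined to
one line. *)
Lemma wedge_D p v : E p -> dist_D p v -> wedge v p = 0.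
Proof.
move=> Ep Dv; have [_ [k [kx ky]]] := image_dist_D Ep Dv.
have [_ [m [mx my]]] := image_dist_D Ep (dist_D_theta p).
by rewrite /wedge kx ky mx my; ring.
Qed.

(** The exterior derivative of the pull-back [dw + v du] is [dv /\ du]; as the
pull-back vanishes on [d_theta], its [theta]-derivative on [h] is that 2-form on
[d_theta] and [h]. The second derivatives of the components cancel by symmetry. *)
Lemma curl h p : E p -> 'D_d_theta (pull h) p = wedge h p.
Proof.
move=> Ep.
have := derive_eq0 h Ep (fun q Eq => pull_D Eq (dist_D_theta q)).
rewrite (derive_pull d_theta h Ep) (derive_pull h d_theta Ep).
rewrite (component_commute iz h d_theta Ep) (component_commute ix h d_theta Ep) /wedge.
set a := 'D_h ('D_d_theta (component iz)) p; set b := 'D_h ('D_d_theta (component ix)) p.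
set c := 'D_h (component ix) p; set d := 'D_h (component iy) p.
move: ('D_d_theta (component ix) p) ('D_d_theta (component iy) p)
  (component iy p) a b c d => *.
lra.
Qed.

Lemma pull_diff h p : E p -> differentiable (pull h) p.
Proof.
move=> Ep.
exact: (differentiable_add_mul (derive_component_diff iz h Ep) (component_diff iy Ep)
  (derive_component_diff ix h Ep)).
Qed.

Lemma pull_basis h p : E p -> pull h p = h 0 0 * pull d_x p + h 0 1 * pull d_y p +
  h 0 2 * pull d_z p + h 0 3 * pull d_theta p.
Proof.
move=> Ep; rewrite /pull (component_basis iz h Ep) (component_basis ix h Ep).
move: ('D_d_x _ p) ('D_d_x _ p) ('D_d_y _ p) ('D_d_y _ p) ('D_d_z _ p) ('D_d_z _ p)
  ('D_d_theta _ p) ('D_d_theta _ p) => *; ring.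
Qed.

Lemma wedge_basis h p : E p -> wedge h p = h 0 0 * wedge d_x p +
  h 0 1 * wedge d_y p + h 0 2 * wedge d_z p.
Proof.
move=> Ep; rewrite /wedge (component_basis iy h Ep) (component_basis ix h Ep).
move: ('D_d_x _ p) ('D_d_x _ p) ('D_d_y _ p) ('D_d_y _ p) ('D_d_z _ p) ('D_d_z _ p)
  ('D_d_theta _ p) ('D_d_theta _ p) => *; ring.
Qed.

(** The pull-back of the contact form on [field_X] and, in [wedge_X], the 2-form on
[field_X] and [d_theta]. *)
Definition pull_X (q : R4) : R := pull d_x q + (- q 0 1) * pull d_z q.
Definition wedge_X (q : R4) : R := wedge d_x q - q 0 1 * wedge d_z q.

Lemma wedgeE h p : wedge h p = 'D_h (component ix) p * 'D_d_theta (component iy) p -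
  'D_d_theta (component ix) p * 'D_h (component iy) p.
Proof. by []. Qed.

Local Opaque pull wedge.

Lemma differentiable_Ny (p : R4) : differentiable (fun q : R4 => - q 0 1) p.
Proof. by apply: differentiableN; exact: differentiable_coord. Qed.

Lemma pull_X_diff p : E p -> differentiable pull_X p.
Proof.
move=> Ep.
exact: (differentiable_add_mul (pull_diff d_x Ep) (differentiable_Ny p)
  (pull_diff d_z Ep)).
Qed.

Lemma derive_pull_X p : E p -> 'D_d_theta pull_X p = wedge_X p.
Proof.
move=> Ep; have D f := @derivable_theta f p.
have := derive_add_mul (D _ (pull_diff d_x Ep)) (D _ (differentiable_Ny p))
  (D _ (pull_diff d_z Ep)).
rewrite -/pull_X => ->; rewrite (curl d_x Ep) (curl d_z Ep).
rewrite (_ : (fun q : R4 => _) = - (fun q : R4 => q 0 1))// deriveN; last first.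
  exact/diff_derivable/differentiable_coord.
rewrite derive_coord entry_d_theta_y /wedge_X.
by move: (wedge d_x p) (wedge d_z p) (pull d_z p) (p 0 1) => *; ring.
Qed.

Lemma pull_frame p : E p ->
  0 + cos (p 0 3 / 2) * pull_X p + sin (p 0 3 / 2) * pull d_y p = 0.
Proof.
move=> Ep; have := pull_D Ep (dist_D_frame_B p).
rewrite (pull_basis _ Ep) /pull_X; have [-> -> -> ->] := frame_BE p.
move: (pull d_x p) (pull d_y p) (pull d_z p) (pull d_theta p) (cos _) (sin _)
  (p 0 1) => a b c d e f g H.
lra.
Qed.

(** The [theta]-derivative of [pull (frame_B p) p = 0] splits into the pull-back on
the quarter turn of [frame_B p] and the term [wedge (frame_B p) p], which is zero.
So the pull-back vanishes on two independent combinations of [field_X] and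
[d_y]. *)
Lemma pull_XY p : E p -> pull_X p = 0 /\ pull d_y p = 0.
Proof.
move=> Ep; have F0 := pull_frame Ep; have := derive_eq0 d_theta Ep pull_frame.
have D f := @derivable_theta f p.
have dc := D _ (differentiable_cos_half p).
have ds := D _ (differentiable_sin_half p).
have dX := D _ (pull_X_diff Ep); have dY := D _ (pull_diff d_y Ep).
have D1 := derive_add_mul (derivable_cst 0 p d_theta) dc dX.
have d1 : derivable (fun q : R4 => 0 + cos (q 0 3 / 2) * pull_X q) p d_theta.
  exact: (derivableD (derivable_cst 0 p d_theta) (derivableM dc dX)).
rewrite (derive_add_mul d1 ds dY) D1.
rewrite (derive_pull_X Ep) (curl d_y Ep) derive_theta_cos_half derive_theta_sin_half.
rewrite derive_cst.
have := wedge_D Ep (dist_D_frame_B p).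
rewrite (wedge_basis _ Ep); have [-> -> -> _] := frame_BE p.
have := cos2Dsin2 (p 0 3 / 2); move: F0; rewrite /wedge_X.
move: (cos _) (sin _) (pull_X p) (pull d_y p) (wedge d_x p) (wedge d_y p) (wedge d_z p).
move=> c s X Y wx wy wz F0 cs W F1.
have F2 : c * Y - s * X = 0 by lra.
split.
  by transitivity ((c ^+ 2 + s ^+ 2) * X - c * (0 + c * X + s * Y) + s * (c * Y - s * X));
    [rewrite F0 F2 cs; ring|ring].
by transitivity ((c ^+ 2 + s ^+ 2) * Y - s * (0 + c * X + s * Y) - c * (c * Y - s * X));
  [rewrite F0 F2 cs; ring|ring].
Qed.

Lemma wedge_XY p : E p -> wedge_X p = 0 /\ wedge d_y p = 0.
Proof.
move=> Ep; rewrite -(derive_pull_X Ep) -(curl d_y Ep).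
by split; apply: derive_eq0 => // q /pull_XY[].
Qed.

Lemma pull_contact p h : E p -> contact p h -> pull h p = 0.
Proof.
move=> Ep; have [pX pY] := pull_XY Ep.
have := pull_D Ep (dist_D_theta p).
rewrite (pull_basis h Ep) pY => ->; move: pX; rewrite /pull_X /contact.
move: (pull d_x p) (pull d_z p) (h 0 0) (h 0 1) (h 0 2) (h 0 3) (p 0 1).
move=> a b h0 h1 h2 h3 y e1 e2.
have -> : a = y * b by lra.
have -> : h2 = - (y * h0) by lra.
by ring.
Qed.

Lemma wedge_contact p h : E p -> contact p h -> wedge h p = 0.
Proof.
move=> Ep; have [wX wY] := wedge_XY Ep.
rewrite (wedge_basis h Ep) wY; move: wX; rewrite /wedge_X /contact.
move: (wedge d_x p) (wedge d_z p) (h 0 0) (h 0 1) (h 0 2) (p 0 1).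
move=> a b h0 h1 h2 y e1 e2.
have -> : a = y * b by lra.
have -> : h2 = - (y * h0) by lra.
by ring.
Qed.

Lemma contact_field_X (p : R4) : contact p (field_X p).
Proof. by rewrite /contact; have [-> _ -> _] := field_X_entries p; ring. Qed.

Lemma contact_d_y (p : R4) : contact p d_y.
Proof. by rewrite /contact; have [-> _ -> _] := d_y_entries; ring. Qed.

Lemma contact_d_theta (p : R4) : contact p d_theta.
Proof. by rewrite /contact; have [-> _ -> _] := d_theta_entries; ring. Qed.

Lemma derive_z p h : E p -> contact p h ->
  'D_h (component iz) p = - (component iy p * 'D_h (component ix) p).
Proof. by move=> Ep /(pull_contact Ep)/eqP; rewrite addr_eq0 => /eqP. Qed.

(** If [(a, b) = (du, dv)(d_theta)] were nonzero, any contact vector [h] could be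
corrected by a multiple of [d_theta] into a vector [V h] whose image is vertical.
The vectors [V (field_X p)] and [V d_y] are independent but have parallel images,
contradicting the injectivity of the differential. *)
Lemma derive_theta_xyz p : E p -> [/\ 'D_d_theta (component ix) p = 0,
  'D_d_theta (component iy) p = 0 & 'D_d_theta (component iz) p = 0].
Proof.
move=> Ep; rewrite (derive_z Ep (contact_d_theta p)).
set a := 'D_d_theta (component ix) p; set b := 'D_d_theta (component iy) p.
suff /eqP : a ^+ 2 + b ^+ 2 = 0.
  by rewrite paddr_eq0 ?sqr_ge0// !sqrf_eq0 => /andP[/eqP-> /eqP->]; rewrite mulr0 oppr0.
apply/eqP/negPn/negP; set m := _ + _ => m0.
have [V Vdef] : exists V : R4 -> R4, forall h, V h = m *: h +
    (- ('D_h (component ix) p * a + 'D_h (component iy) p * b)) *: d_theta by eexists.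
have VE h i : 'D_(V h) (component i) p = m * 'D_h (component i) p -
   ('D_h (component ix) p * a + 'D_h (component iy) p * b) * 'D_d_theta (component i) p.
  by rewrite Vdef (derive_dirD _ _ _ _ (component_diff i Ep)) [X in _ + X]mulNr.
have V0 h : contact p h -> [/\ 'D_(V h) (component ix) p = 0,
    'D_(V h) (component iy) p = 0 & 'D_(V h) (component iz) p = 0].
  move=> ch; have := wedge_contact Ep ch.
  rewrite !VE (derive_z Ep ch) (derive_z Ep (contact_d_theta p)) wedgeE -/a -/b /m.
  exact: project_parallel.
have [X0 X1 X2] := V0 _ (contact_field_X p).
have [Y0 Y1 Y2] := V0 _ (contact_d_y p).
set r := 'D_(V d_y) (component ith) p; set s := 'D_(V (field_X p)) (component ith) p.
have VX0 : V (field_X p) 0 0 = m.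
  rewrite Vdef entry_comb; have [-> _ _ _] := field_X_entries p.
  by have [-> _ _ _] := d_theta_entries; rewrite mulr1 mulr0 addr0.
have VX1 : V (field_X p) 0 1 = 0.
  rewrite Vdef entry_comb; have [_ -> _ _] := field_X_entries p.
  by have [_ -> _ _] := d_theta_entries; rewrite !mulr0 addr0.
have VY1 : V d_y 0 1 = m.
  rewrite Vdef entry_comb; have [_ -> _ _] := d_y_entries.
  by have [_ -> _ _] := d_theta_entries; rewrite mulr1 mulr0 addr0.
have : r *: V (field_X p) + (- s) *: V d_y = 0.
  have VD i := derive_dirD (V (field_X p)) (V d_y) r (- s) (component_diff i Ep).
  apply: (derive_map_eq0 Ep); apply: (etrans (VD _)).
  - exact: comb_eq0 X0 Y0.
  - exact: comb_eq0 X1 Y1.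
  - exact: comb_eq0 X2 Y2.
  - by rewrite -/r -/s [_ *: _]mulrC [X in _ + X]mulNr subrr.
move=> /rowP/(_ 1); rewrite entry_comb VX1 VY1 [RHS]mxE mulr0 add0r mulNr => /eqP.
rewrite oppr_eq0 mulf_eq0 (negPf m0) orbF => /eqP s0.
have /rowP/(_ 0) : V (field_X p) = 0 by exact: (derive_map_eq0 Ep).
by rewrite VX0 [RHS]mxE => /eqP; rewrite (negPf m0).
Qed.

End OneMap.
End EngelMaps.

(** * Twisting along the vertical leaves *)

Section Twisting.
Context {R : realType}.
Local Notation R4 := 'rV[R]_4.

Lemma sin_eq0_pi_le (z : R) : sin z = 0 -> z != 0 -> pi <= `|z|.
Proof.
move=> sz z0; rewrite leNgt; apply/negP => zpi.
have : 0 < sin `|z| by apply: sin_gt0_pi; rewrite normr_gt0 z0.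
have [h|h] := leP 0 z; first by rewrite (ger0_norm h) sz ltxx.
by rewrite (ltr0_norm h) sinN sz oppr0 ltxx.
Qed.

Definition vertically_convex (E : set R4) := forall p r s, 0 <= r <= s ->
  E p -> E (p + s *: d_theta) -> E (p + r *: d_theta).

Context (E : set R4) (A : R4 -> R4).
Hypotheses (oE : open E) (cE : vertically_convex E) (mA : engel_map E A).
Notation component := (component A).

Lemma frame_B_2pi (p : R4) : frame_B (p + (2 * pi) *: d_theta) = - frame_B p.
Proof.
have e : coord_theta (p + (2 * pi) *: d_theta) / 2 = coord_theta p / 2 + pi.
  by rewrite /coord_theta !mxE /=; field.
rewrite /frame_B e cosDpi sinDpi !scaleNr -opprD; congr (- (_ *: _ + _)).
by rewrite /field_X /coord_y !mxE /= mulr0 addr0.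
Qed.

Local Opaque ix iy iz ith d_x d_y d_z d_theta field_X frame_B.

Lemma derive_theta_neq0 p : E p -> 'D_d_theta (component ith) p != 0.
Proof.
move=> Ep; apply/negP => /eqP t0; have [x0 y0 z0] := derive_theta_xyz oE mA Ep.
have /rowP/(_ 3) := derive_map_eq0 mA Ep x0 y0 z0 t0.
have [_ _ _ ->] := @d_theta_entries R.
by rewrite mxE => /eqP; rewrite oner_eq0.
Qed.

(** If the image of [frame_B p] were vertical, it would be parallel to the image of
[d_theta]. *)
Lemma image_frame p : E p -> exists k, [/\ k != 0,
  'D_(frame_B p) (component ix) p = k * cos (component ith p / 2) &
  'D_(frame_B p) (component iy) p = k * sin (component ith p / 2)].
Proof.
move=> Ep; have DB := dist_D_frame_B p.
have [B2 [k [B0 B1]]] := image_dist_D mA Ep DB.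
exists k; split => //; apply/eqP => k0; rewrite k0 mul0r in B0; rewrite k0 mul0r in B1.
rewrite B0 mulr0 addr0 in B2.
have [x0 y0 z0] := derive_theta_xyz oE mA Ep.
set t := 'D_d_theta (component ith) p; set a := 'D_(frame_B p) (component ith) p.
have t0 : t != 0 := derive_theta_neq0 Ep.
have V0 : t *: frame_B p + (- a) *: d_theta = 0.
  have VD i := derive_dirD (frame_B p) d_theta t (- a) (component_diff oE mA i Ep).
  apply: (derive_map_eq0 mA Ep); apply: (etrans (VD _)).
  - exact: comb_eq0 B0 x0.
  - exact: comb_eq0 B1 y0.
  - exact: comb_eq0 B2 z0.
  - by rewrite -/t -/a [_ *: _]mulrC [X in _ + X]mulNr subrr.
have [Bx By _ _] := frame_BE p; have [Tx Ty _ _] := @d_theta_entries R.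
have /rowP/(_ 0) := V0; rewrite entry_comb Bx Tx [RHS]mxE mulr0 addr0 => c0.
have /rowP/(_ 1) := V0; rewrite entry_comb By Ty [RHS]mxE mulr0 addr0 => s0.
have := cos2Dsin2 (p 0 3 / 2).
move/eqP: c0; rewrite mulf_eq0 (negPf t0) => /eqP ->.
move/eqP: s0; rewrite mulf_eq0 (negPf t0) => /eqP ->.
by move=> /eqP; rewrite expr0n/= addr0 eq_sym oner_eq0.
Qed.

Lemma leaf_constant (f : R4 -> R) p s : 0 <= s -> E p -> E (p + s *: d_theta) ->
  (forall q, E q -> differentiable f q) ->
  (forall q, E q -> 'D_d_theta f q = 0) -> f (p + s *: d_theta) = f p.
Proof.
rewrite le_eqVlt => /predU1P[<- _ _ _ _|s0 Ep Es df f0].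
  by rewrite scale0r addr0.
have [r rs|r rs] := @mean_value_line R _ f p d_theta s s0.
  by apply: df; exact: cE rs Ep Es.
by rewrite f0 ?mul0r; [move/eqP; rewrite subr_eq0 => /eqP|exact: cE rs Ep Es].
Qed.

Definition horizontal (i : 'I_4) := [\/ i = ix, i = iy | i = iz].

Lemma derive_theta_horizontal i p : horizontal i -> E p ->
  'D_d_theta (component i) p = 0.
Proof.
by move=> hi Ep; have [x0 y0 z0] := derive_theta_xyz oE mA Ep; case: hi => ->.
Qed.

Lemma leaf_component i p s : horizontal i -> 0 <= s -> E p -> E (p + s *: d_theta) ->
  component i (p + s *: d_theta) = component i p.
Proof.
move=> hi s0 Ep Es; apply: (@leaf_constant (component i)) => // q Eq.
  exact: (component_diff oE mA i Eq).
exact: derive_theta_horizontal.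
Qed.

(** By the symmetry of second derivatives, the [theta]-derivative of ['D_h u] is the
[h]-derivative of zero. *)
Lemma leaf_derive_component i h p s : horizontal i -> 0 <= s ->
  E p -> E (p + s *: d_theta) ->
  'D_h (component i) (p + s *: d_theta) = 'D_h (component i) p.
Proof.
move=> hi s0 Ep Es.
apply: (@leaf_constant ('D_h (component i))) => // q Eq.
  exact: (derive_component_diff oE mA i h Eq).
rewrite (component_commute oE mA i h d_theta Eq); apply: (derive_eq0 oE h Eq) => q' Eq'.
exact: derive_theta_horizontal.
Qed.

Lemma horizontal_x : horizontal ix. Proof. by constructor 1. Qed.
Lemma horizontal_y : horizontal iy. Proof. by constructor 2. Qed.
Lemma horizontal_z : horizontal iz. Proof. by constructor 3. Qed.

Lemma leaf_inj p s : 0 < s -> E p -> E (p + s *: d_theta) ->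
  component ith (p + s *: d_theta) != component ith p.
Proof.
move=> s0 Ep Es; apply/eqP => e.
have := em_inj mA Es Ep.
have ex := leaf_component horizontal_x (ltW s0) Ep Es.
have ey := leaf_component horizontal_y (ltW s0) Ep Es.
have ez := leaf_component horizontal_z (ltW s0) Ep Es.
move=> /(_ (rv4P ex ey ez e))/eqP; rewrite -subr_eq0 addrAC subrr add0r.
move=> /eqP/rowP/(_ 3); have [_ _ _ t1] := @d_theta_entries R.
by rewrite mxE t1 mulr1 mxE => /eqP; rewrite gt_eqF.
Qed.

(** Over one period [frame_B] changes sign while the differential of the horizontal
components does not change, so the unit vectors with angles [t/2] and [t'/2] are
parallel. The angles differ, since [A] is injective on the leaf, hence by at
least [pi]. *)
Lemma twist_step p : E p -> E (p + (2 * pi) *: d_theta) ->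
  2 * pi <= `|component ith (p + (2 * pi) *: d_theta) - component ith p|.
Proof.
move=> Ep Es; have pi0 := pi_gt0 R; have s0 : 0 < 2 * pi :> R by rewrite mulr_gt0.
have := leaf_inj s0 Ep Es.
have [k [k0 kx ky]] := image_frame Ep.
have [m [m0 mx my]] := image_frame Es.
have Neg i : horizontal i ->
    'D_(frame_B (p + (2 * pi) *: d_theta)) (component i) (p + (2 * pi) *: d_theta) =
    - 'D_(frame_B p) (component i) p.
  move=> hi; rewrite (leaf_derive_component _ hi (ltW s0) Ep Es) frame_B_2pi.
by rewrite !deriveE ?linearN//; exact: (component_diff oE mA i Ep).
move: mx my; rewrite (Neg _ horizontal_x) (Neg _ horizontal_y) kx ky.
move: (component ith p) (component ith (p + _)) => t t' ex ey tt.
have sz : sin ((t' - t) / 2) = 0.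
  rewrite mulrBl sinB; apply: (mulfI k0).
  rewrite mulr0; move: ex ey.
  move: (sin (t' / 2)) (cos (t / 2)) (sin (t / 2)) (cos (t' / 2)).
  move=> s' c s c' ex ey.
  transitivity (s' * (k * c) - c' * (k * s)); first by ring.
  have -> : k * c = - (m * c') by lra.
  have -> : k * s = - (m * s') by lra.
  by ring.
have zN0 : (t' - t) / 2 != 0.
  by rewrite mulf_neq0// ?invr_eq0 ?pnatr_eq0// subr_eq0.
have := sin_eq0_pi_le sz zN0; rewrite normrM [`|2^-1|]ger0_norm//; lra.
Qed.

Lemma iter_step (T : R -> R) (d c : R) (k : nat) : 0 <= d ->
  (forall r, 0 <= r -> r + d <= k%:R * d -> T r + c <= T (r + d)) ->
  T 0 + k%:R * c <= T (k%:R * d).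
Proof.
move=> d0; elim: k => [|k IH] step; first by rewrite !mul0r addr0.
have /IH IHk : forall r, 0 <= r -> r + d <= k%:R * d -> T r + c <= T (r + d).
  by move=> r r0 rk; apply: step => //; rewrite mulrS mulrDl mul1r; lra.
have := step (k%:R * d); rewrite mulr_ge0//.
by rewrite [k.+1%:R]mulrS !mulrDl !mul1r [d + _]addrC => /(_ isT (lexx _)); lra.
Qed.

(** The last component is continuous and injective on the leaf, hence monotone, so
the increments over the successive periods add up. *)
Lemma twist p (k : nat) : E p -> E (p + (k%:R * (2 * pi)) *: d_theta) ->
  k%:R * (2 * pi) <=
  `|component ith (p + (k%:R * (2 * pi)) *: d_theta) - component ith p|.
Proof.
move=> Ep Ek; set d := 2 * pi in Ek *; set S := k%:R * d in Ek *.
have d0 : 0 < d by rewrite mulr_gt0// pi_gt0.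
pose T r := component ith (p + r *: d_theta).
have ET r : 0 <= r <= S -> E (p + r *: d_theta) by move=> rS; exact: cE rS Ep Ek.
have T0 : T 0 = component ith p by rewrite /T scale0r addr0.
have split_line r r' : p + r' *: d_theta = p + r *: d_theta + (r' - r) *: d_theta.
  by rewrite -addrA -scalerDl addrC [r + _]addrC subrK addrC.
have Tinj : {in `[0, S] &, injective T}.
  have lt_ne r r' : 0 <= r <= S -> 0 <= r' <= S -> r < r' -> T r' != T r.
    move=> rS rS' rr; rewrite /T (split_line r r'); apply: leaf_inj.
    - by rewrite subr_gt0.
    - exact: ET.
    - by rewrite -split_line; exact: ET.
  move=> r r'; rewrite !in_itv /= => rS rS' e.
  have [rr|rr|//] := ltgtP r r'.
    by have := lt_ne _ _ rS rS' rr; rewrite e eqxx.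
  by have := lt_ne _ _ rS' rS rr; rewrite e eqxx.
have Tcont : {within `[0, S], continuous T}.
  apply: derivable_within_continuous => r; rewrite in_itv /= => rS.
  have := is_derive_line (component_diff oE mA ith (ET r rS)).
  by move=> H; exact: ex_derive.
have Tstep r : 0 <= r -> r + d <= S -> d <= `|T (r + d) - T r|.
  move=> r0 rd; rewrite /T scalerDl addrA; apply: twist_step.
    by apply: ET; apply/andP; split=> //; lra.
  by rewrite -addrA -scalerDl -/d; apply: ET; apply/andP; split=> //; lra.
rewrite -/(T S) -T0.
have [Tmono|Tmono] := itv_continuous_inj_mono Tcont Tinj.
  have := @iter_step T d d k (ltW d0); rewrite -/S.
  move=> H; rewrite ler_normr; apply/orP; left.
  suff : T 0 + S <= T S by lra.
  apply: H => r r0 rd; have := Tstep r r0 rd.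
  rewrite gtr0_norm; first by lra.
  by rewrite subr_gt0; apply: Tmono; rewrite ?in_itv/=; try (apply/andP; split); lra.
have := @iter_step (fun r => - T r) d d k (ltW d0); rewrite -/S.
move=> H; rewrite ler_normr; apply/orP; right.
suff : - T 0 + S <= - T S by lra.
apply: H => r r0 rd; have := Tstep r r0 rd.
rewrite ltr0_norm; first by lra.
by rewrite subr_lt0; apply: Tmono; rewrite ?in_itv/=; try (apply/andP; split); lra.
Qed.

End Twisting.

(** * The inverse of an automorphism *)

Section Inverse.
Context {R : realType}.
Local Notation R4 := 'rV[R]_4.

Lemma derive_inverse {V W : normedModType R} (A : V -> W) (G : W -> V) (p v : V) :
  differentiable A p -> differentiable G (A p) ->
  (\forall q \near p, G (A q) = q) -> 'D_('D_v A p) G (A p) = v.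
Proof.
move=> dA dG GA.
have dc : differentiable (G \o A) p by exact: differentiable_comp.
have Ev : 'D_v (G \o A) p = v.
  by rewrite (@near_eq_derive _ _ _ _ id) ?derive_id.
apply: (etrans _ Ev).
by rewrite (deriveE _ dc) diff_comp//= (deriveE _ dG) (deriveE _ dA).
Qed.

Section Onto.
Context (E : set R4) (A : R4 -> R4).
Hypotheses (oE : open E) (mA : engel_map E A).

(** The differential is injective and both fibres are planes, so it maps the one
onto the other. *)
Lemma preserve_onto p w : E p -> dist_D (A p) w ->
  exists2 v, dist_D p v & 'D_v A p = w.
Proof.
move=> Ep [a [b ->]]; rewrite -/(frame_B (A p)).
have dA := em_diff mA Ep.
have [c [d]] := em_preserve mA Ep (dist_D_frame_B p).
rewrite -/(frame_B (A p)) => DB.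
set t := 'D_d_theta (component A ith) p.
have t0 : t != 0 := derive_theta_neq0 oE mA Ep.
have Dt : 'D_d_theta A p = t *: d_theta.
  have [x0 y0 z0] := derive_theta_xyz oE mA Ep.
  have [e0 e1 e2 e3] := @d_theta_entries R.
  apply: rv4P; rewrite [RHS]mxE.
  - by rewrite e0 mulr0; exact: (etrans (derive_componentE mA ix d_theta Ep) x0).
  - by rewrite e1 mulr0; exact: (etrans (derive_componentE mA iy d_theta Ep) y0).
  - by rewrite e2 mulr0; exact: (etrans (derive_componentE mA iz d_theta Ep) z0).
  - by rewrite e3 mulr1; exact: (derive_componentE mA ith d_theta Ep).
have d0 : d != 0.
  apply/eqP => d0; rewrite d0 scale0r addr0 in DB.
  have [k [k0]] := image_frame oE mA Ep.
  have [e0 e1 e2 e3] := @d_theta_entries R.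
  rewrite -!(derive_componentE mA _ _ Ep) DB.
  have -> : (c *: d_theta) 0 ix = 0 :> R by rewrite mxE e0 mulr0.
  have -> : (c *: d_theta) 0 iy = 0 :> R by rewrite mxE e1 mulr0.
  move=> /esym/eqP; rewrite mulf_eq0 (negPf k0) => /eqP h0.
  move=> /esym/eqP; rewrite mulf_eq0 (negPf k0) => /eqP h1.
  have /eqP := cos2Dsin2 (component A ith p / 2).
  by rewrite h0 h1 expr0n /= addr0 eq_sym oner_eq0.
exists ((a - b / d * c) / t *: d_theta + b / d *: frame_B p).
  by eexists; eexists.
rewrite (derive_dirD _ _ _ _ dA) Dt DB.
rewrite scalerA divfK// scalerDr addrA scalerA -scalerDl subrK scalerA divfK//.
Qed.

End Onto.

Lemma engel_map_inverse (E : set R4) (A G : R4 -> R4) : open E ->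
  smooth_on E A -> smooth_on E G ->
  (forall p, E p -> E (A p)) -> (forall p, E p -> E (G p)) ->
  (forall p, E p -> G (A p) = p) -> (forall p, E p -> A (G p) = p) ->
  (forall p v, E p -> dist_D p v -> dist_D (A p) ('D_v A p)) ->
  engel_map E A /\ engel_map E G.
Proof.
move=> oE sA sG AE GE GA AG AD.
have dA p : E p -> differentiable A p by have [d _] := sA 1%N; exact: d.
have dG p : E p -> differentiable G p by have [d _] := sG 1%N; exact: d.
have invGA p v : E p -> 'D_('D_v A p) G (A p) = v.
  move=> Ep; apply: derive_inverse; [exact: dA|exact/dG/AE|].
  by apply: filterS (near_open oE Ep) => q /GA.
have invAG p v : E p -> 'D_('D_v G p) A (G p) = v.
  move=> Ep; apply: derive_inverse; [exact: dG|exact/dA/GE|].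
  by apply: filterS (near_open oE Ep) => q /AG.
have mA : engel_map E A.
  split=> // [p q Ep Eq e|p v Ep v0].
    by rewrite -(GA p Ep) -(GA q Eq) e.
  by rewrite -(invGA p v Ep) v0 derive0.
split=> //; split=> // [p q Ep Eq e|p v Ep v0|q w Eq Dw].
- by rewrite -(AG p Ep) -(AG q Eq) e.
- by rewrite -(invAG p v Ep) v0 derive0.
- have [|v Dv <-] := @preserve_onto E A oE mA (G q) w (GE q Eq).
    by rewrite AG.
  by have := invGA (G q) v (GE q Eq); rewrite AG// => ->.
Qed.

End Inverse.

(** * The domain and the length of its leaves *)

Section Domain.
Context {R : realType}.
Local Notation R4 := 'rV[R]_4.

(** The leaves are the intersections of the domain with the fibres of [base]. *)
Definition base (p : R4) : 'rV[R]_3 := @lsubmx R 1 3 1 p.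

Lemma base_entry (p : R4) (j : 'I_3) : base p 0 j = p 0 (@lshift 3 1 j).
Proof. by rewrite mxE. Qed.

Lemma base_inj (p q : R4) : base p = base q -> p 0 3 = q 0 3 -> p = q.
Proof.
move=> /rowP e e3; apply: rv4P => //.
- have := e 0; rewrite !base_entry.
  by rewrite (_ : lshift 1 0 = 0)//; apply/val_inj.
- have := e 1; rewrite !base_entry.
  by rewrite (_ : lshift 1 1 = 1)//; apply/val_inj.
- have := e 2; rewrite !base_entry.
  by rewrite (_ : lshift 1 2 = 2)//; apply/val_inj.
Qed.

Lemma base_eqP (p q : R4) : p 0 0 = q 0 0 -> p 0 1 = q 0 1 -> p 0 2 = q 0 2 ->
  base p = base q.
Proof.
move=> e0 e1 e2; apply/rowP => -[[|[|[|]]]//= i]; rewrite !base_entry.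
- by rewrite (_ : @lshift 3 1 (Ordinal i) = (0 : 'I_4))//; apply/val_inj.
- by rewrite (_ : @lshift 3 1 (Ordinal i) = (1 : 'I_4))//; apply/val_inj.
- by rewrite (_ : @lshift 3 1 (Ordinal i) = (2 : 'I_4))//; apply/val_inj.
Qed.

Lemma base_eqE (p q : R4) : base p = base q ->
  [/\ p 0 0 = q 0 0, p 0 1 = q 0 1 & p 0 2 = q 0 2].
Proof.
move=> /rowP e; split.
- have := e 0; rewrite !base_entry.
  by rewrite (_ : lshift 1 0 = 0)//; apply/val_inj.
- have := e 1; rewrite !base_entry.
  by rewrite (_ : lshift 1 1 = 1)//; apply/val_inj.
- have := e 2; rewrite !base_entry.
  by rewrite (_ : lshift 1 2 = 2)//; apply/val_inj.
Qed.

Lemma base_point4 (v : 'rV[R]_3) t : base (point4 v t) = v.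
Proof. by rewrite /base /point4 row_mxKl. Qed.

Lemma point4_theta (v : 'rV[R]_3) t : point4 v t 0 3 = t.
Proof.
rewrite /point4 mxE; case: splitP => j /= e; last by rewrite (ord1 j) mxE mulr1n.
by have := ltn_ord j; rewrite -e.
Qed.

Lemma point4_base (p : R4) : point4 (base p) (p 0 3) = p.
Proof. by apply: base_inj; [exact: base_point4|exact: point4_theta]. Qed.

Lemma base_vertical (p : R4) r : base (p + r *: d_theta) = base p.
Proof. by apply: base_eqP; rewrite !mxE /= mulr0 addr0. Qed.

Lemma theta_vertical (p : R4) r : (p + r *: d_theta) 0 3 = p 0 3 + r.
Proof. by rewrite !mxE /= mulr1. Qed.

Lemma vertical_eq (p q : R4) : base p = base q -> q = p + (q 0 3 - p 0 3) *: d_theta.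
Proof.
by move=> e; apply: base_inj; rewrite ?base_vertical ?theta_vertical// addrC subrK.
Qed.

Context (x : nat -> 'rV[R]_3) (eps : R).
Hypotheses (x_inj : injective x) (x_dense : dense (range x)).
Hypotheses (eps_gt0 : 0 < eps) (eps_le : eps <= 2 * pi).
Local Notation E := (domain_E x eps).

Lemma in_domain p : E p <-> forall i, base p = x i ->
  - (i.+1%:R * pi) < p 0 3 < i.+1%:R * pi + eps.
Proof.
split=> [Ep i bi|h [i _ [t ht pE]]].
  rewrite !ltNge -negb_or; apply/negP => out; apply: Ep; exists i => //.
  exists (p 0 3); last by rewrite -bi point4_base.
  by rewrite /= !in_itv /= andbT; apply/orP.
have := h i; rewrite -pE base_point4 point4_theta => /(_ erefl)/andP[h1 h2].
by move: ht; rewrite /= !in_itv /= andbT leNgt h1 /= leNgt h2 => -[].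
Qed.

Lemma near_entry_lt (p : R4) (i : 'I_4) (c : R) : p 0 i < c ->
  \forall q \near p, (q : R4) 0 i < c.
Proof. by move=> pc; exact: (cvgr_lt _ (@coord_continuous _ _ _ 0 i p)). Qed.

Lemma near_entry_gt (p : R4) (i : 'I_4) (c : R) : c < p 0 i ->
  \forall q \near p, c < (q : R4) 0 i.
Proof. by move=> pc; exact: (cvgr_gt _ (@coord_continuous _ _ _ 0 i p)). Qed.

Lemma near_entry_neq (p : R4) (i : 'I_4) (c : R) : p 0 i != c ->
  \forall q \near p, (q : R4) 0 i != c.
Proof.
rewrite neq_lt => /orP[/near_entry_lt|/near_entry_gt]; apply: filterS => q h.
  by rewrite lt_eqF.
by rewrite gt_eqF.
Qed.

Lemma near_base_neq (p : R4) (v : 'rV[R]_3) : base p != v ->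
  \forall q \near p, base q != v.
Proof.
move=> ne; have [j hj] : exists j, base p 0 j != v 0 j.
  apply: contrapT => /forallNP h; move/eqP: ne; apply; apply/rowP => j.
  by have /negP := h j; rewrite negbK => /eqP.
rewrite base_entry in hj; apply: filterS (near_entry_neq hj) => q.
by apply: contra => /eqP <-; rewrite base_entry.
Qed.

(** The removed rays accumulate nowhere: in a bounded range of [theta] only finitely
many of them are present. *)
Lemma domain_open : open E.
Proof.
rewrite openE => p Ep.
have pi0 := pi_gt0 R.
(* Rays of index at least [N] stay out of a unit neighbourhood of [p]. *)
pose N := (Num.trunc ((`|p 0 3| + 1) / pi)).+1.
have hN : `|p 0 3| + 1 < N%:R * pi.
  by rewrite -ltr_pdivrMr// /N truncnS_gt.
suff : \forall q \near p, E q by [].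
have near_i (i : 'I_N) : \forall q \near p, base q = x i ->
    - (i.+1%:R * pi) < q 0 3 < i.+1%:R * pi + eps.
  have [bi|ne] := eqVneq (base p) (x i); last first.
    by apply: filterS (near_base_neq ne) => q /eqP.
  have /andP[h1 h2] := (in_domain p).1 Ep i bi.
  by apply: filterS (filterI (near_entry_gt h1) (near_entry_lt h2)) => q [-> ->].
have near_b : \forall q \near p, - (N%:R * pi) < (q : R4) 0 3.
  by apply: near_entry_gt; have := ler_norm (- p 0 3); rewrite normrN; lra.
have near_c : \forall q \near p, (q : R4) 0 3 < N%:R * pi.
  by apply: near_entry_lt; have := ler_norm (p 0 3); lra.
apply: filterS (filterI (filter_forall _ near_i) (filterI near_b near_c)).
move=> q [hq [hb hc]]; apply/in_domain => i bi.
have [iN|Ni] := ltnP i N; first exact: (hq (Ordinal iN)).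
have : N%:R * pi <= i.+1%:R * pi :> R.
  by apply: ler_wpM2r; [exact: ltW|rewrite ler_nat leqW].
move: hb hc; move: (N%:R * pi) (i.+1%:R * pi) eps_gt0 => a b e hb hc h.
by apply/andP; split; lra.
Qed.

Lemma domain_convex : vertically_convex E.
Proof.
move=> p r s /andP[r0 rs] /in_domain h0 /in_domain h1; apply/in_domain => i.
move: (h0 i) (h1 i); rewrite !base_vertical !theta_vertical => {}h0 {}h1 bi.
have /andP[a b] := h0 bi; have /andP[c d] := h1 bi.
by apply/andP; split; lra.
Qed.

Lemma continuous_point4 t : continuous (fun v : 'rV[R]_3 => point4 v t).
Proof.
have oT : open [set: 'rV[R]_3] := openT.
have C : class_C 0 setT (fun v : 'rV[R]_3 => point4 v t).
  apply: class_C_mx => // i j; rewrite (ord1 i).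
  apply: (@class_C_eq R 'rV[R]_3 R setT 0 (fun v : 'rV[R]_3 =>
     match fintype.split (j : 'I_(3 + 1)) with
     | inl k => v 0 k | inr k => (t%:M : 'rV[R]_1) 0 k end)) => //.
    by move=> q _; rewrite [RHS]mxE.
  case: (fintype.split _) => k; last exact: class_C_cst.
  by apply: (@class_C_entry R 'rV[R]_3 1 3 setT 0 id 0 k) => //; exact: class_C_id.
by move=> v; exact: C.
Qed.

(** Translating the point [p] horizontally keeps its height, so it suffices to move
[base p] to a nearby point of the dense set. *)
Lemma domain_dense (P : set R4) p : E p -> (\forall q \near p, P q) ->
  exists n q, [/\ P q, E q & base q = x n].
Proof.
move=> Ep NP.
have NPE : \forall q \near p, P q /\ E q by exact: filterI NP (near_open domain_open Ep).
have : \forall v \near base p, P (point4 v (p 0 3)) /\ E (point4 v (p 0 3)).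
  have C := @continuous_point4 (p 0 3) (base p).
  by rewrite /continuous_at point4_base in C; exact: (C _ NPE).
rewrite /prop_near1 nbhsE => -[U [oU Ub] UP].
have [v [Uv [n _ xn]]] := x_dense (ex_intro _ _ Ub) oU.
exists n, (point4 v (p 0 3)); have [Pv Ev] := UP _ Uv.
by rewrite base_point4.
Qed.

Lemma dense_eq0 (h : R4 -> R) p : E p -> {for p, continuous h} ->
  (forall q n, E q -> base q = x n -> h q = 0) -> h p = 0.
Proof.
move=> Ep hc h0; apply/eqP/negPn/negP => hp.
have Nh : \forall q \near p, h q != 0 by exact: (cvgr_neq0 _ hc).
have [n [q [hq Eq bq]]] := domain_dense Ep Nh.
by move: hq; rewrite (h0 q n Eq bq) eqxx.
Qed.

(** The leaf over [b] contains [k] full periods. *)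
Definition twisted (k : nat) (b : 'rV[R]_3) : Prop := exists p,
  [/\ E p, base p = b & E (p + (k%:R * (2 * pi)) *: d_theta)].

Section Leaves.
Context (A : R4 -> R4).
Hypothesis (mA : engel_map E A).
Let oE := domain_open.
Let cE := domain_convex.

Lemma base_image p q : E p -> E q -> base p = base q -> base (A p) = base (A q).
Proof.
wlog pq : p q / p 0 3 <= q 0 3 => [H|] Ep Eq e.
  by have [/H|/ltW/H] := leP (p 0 3) (q 0 3); [exact|move=> h; apply/esym/h].
have eq := vertical_eq e; have s0 : 0 <= q 0 3 - p 0 3 by rewrite subr_ge0.
move: Eq; rewrite eq => Eq; apply: base_eqP; apply/esym.
- exact: (leaf_component oE cE mA horizontal_x s0 Ep Eq).
- exact: (leaf_component oE cE mA horizontal_y s0 Ep Eq).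
- exact: (leaf_component oE cE mA horizontal_z s0 Ep Eq).
Qed.

(** The image leaf has length [2 (m+1) pi + eps <= 2 (m+2) pi], and being open it
cannot contain [m+2] full periods. *)
Lemma twisted_image k p m : E p -> twisted k (base p) -> base (A p) = x m ->
  (k <= m.+1)%N.
Proof.
move=> Ep [q [Eq bq Eq']] bA; have pi0 := pi_gt0 R.
have tw := twist oE cE mA Eq Eq'.
have b1 : base (A q) = x m by rewrite -bA; exact: base_image.
have b2 : base (A (q + (k%:R * (2 * pi)) *: d_theta)) = x m.
  by rewrite -bA; apply: base_image => //; rewrite base_vertical.
have /andP[h1 h2] := (in_domain _).1 (em_stable mA Eq) _ b1.
have /andP[h3 h4] := (in_domain _).1 (em_stable mA Eq') _ b2.
have lt : k%:R * (2 * pi) < m.+2%:R * (2 * pi) :> R.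
  apply: (le_lt_trans tw); move: h1 h2 h3 h4; rewrite /component /ith.
  have -> : m.+2%:R * (2 * pi) = 2 * pi + 2 * (m.+1%:R * pi) :> R.
    by rewrite [m.+2%:R]mulrS; ring.
  move: (m.+1%:R * pi) eps_le => c e h1 h2 h3 h4.
  by rewrite ltr_norml; apply/andP; split; lra.
move: lt; rewrite ltr_pM2r; last by rewrite mulr_gt0.
by rewrite ltr_nat ltnS.
Qed.

End Leaves.

Lemma twisted_x n : twisted n.+1 (x n).
Proof.
have pi0 := pi_gt0 R.
(* The slack [eps] is shared equally between the two ends. *)
exists (point4 (x n) (- (n.+1%:R * pi) + eps / 2)); split.
- apply/in_domain => i; rewrite base_point4 point4_theta => /x_inj <-.
  have : 0 < n.+1%:R * pi :> R by rewrite mulr_gt0.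
  by move: (n.+1%:R * pi) eps_gt0 => c h1 h2; apply/andP; split; lra.
- exact: base_point4.
- apply/in_domain => i; rewrite base_vertical theta_vertical.
  rewrite base_point4 point4_theta => /x_inj <-.
  rewrite mulrCA; have : 0 < n.+1%:R * pi :> R by rewrite mulr_gt0.
  by move: (n.+1%:R * pi) eps_gt0 => c h1 h2; apply/andP; split; lra.
Qed.

Lemma twisted_generic k b : (forall m, b <> x m) -> twisted k b.
Proof.
move=> bx; exists (point4 b 0); split; last 2 first.
- exact: base_point4.
- by apply/in_domain => i; rewrite base_vertical base_point4 => /bx.
by apply/in_domain => i; rewrite base_point4 => /bx.
Qed.

(** The number of full periods of the leaf over [x n] does not decrease under [A],
nor under [G]; since this number determines [n] and is unbounded on the infinite
leaves, the leaf is mapped to itself. *)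
Lemma base_fixed (A G : R4 -> R4) n p : engel_map E A -> engel_map E G ->
  (forall q, E q -> G (A q) = q) -> E p -> base p = x n -> base (A p) = x n.
Proof.
move=> mA mG GA Ep bp.
have EA := em_stable mA Ep; have GAp := GA p Ep.
have bound k : twisted k (base (A p)) -> (k <= n.+1)%N.
  by move=> lk; apply: (twisted_image mG EA lk); rewrite GAp.
have [[m bm]|ne] := pselect (exists m, base (A p) = x m); last first.
  suff /bound : twisted n.+2 (base (A p)) by rewrite ltnn.
  by apply: twisted_generic => m e; apply: ne; exists m.
have nm : (n.+1 <= m.+1)%N.
  by apply: (twisted_image mA Ep _ bm); rewrite bp; exact: twisted_x.
have mn : (m.+1 <= n.+1)%N by apply: bound; rewrite bm; exact: twisted_x.
by rewrite bm; congr (x _); apply/eqP; rewrite eqn_leq -ltnS mn -ltnS.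
Qed.

End Domain.

(** * Triviality of the automorphism group *)

Section Final.
Context {R : realType}.
Local Notation R4 := 'rV[R]_4.
Context (x : nat -> 'rV[R]_3) (eps : R).
Hypotheses (x_inj : injective x) (x_dense : dense (range x)).
Hypotheses (eps_gt0 : 0 < eps) (eps_le : eps <= 2 * pi).
Local Notation E := (domain_E x eps).

Let oE := @domain_open R x eps eps_gt0.
Let cE := @domain_convex R x eps.

Lemma engel_map_base (A G : R4 -> R4) p : engel_map E A -> engel_map E G ->
  (forall q, E q -> G (A q) = q) -> E p -> base (A p) = base p.
Proof.
move=> mA mG GA Ep.
have dA : differentiable A p := em_diff mA Ep.
have coord i : (forall q n, E q -> base q = x n -> A q 0 i - q 0 i = 0) ->
    A p 0 i = p 0 i.
  move=> h; apply/eqP; rewrite -subr_eq0; apply/eqP.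
  apply: (@dense_eq0 _ _ _ x_dense eps_gt0 (fun q => A q 0 i - q 0 i) p Ep) => //.
  apply: differentiable_continuous; apply: differentiableB.
    exact: differentiable_entry.
  exact: differentiable_coord.
have base_fixedE q n : E q -> base q = x n -> base (A q) = base q.
  by move=> Eq bq; rewrite bq; exact: (base_fixed x_inj eps_gt0 eps_le mA mG GA Eq bq).
by apply: base_eqP; apply: coord => q n Eq /(base_fixedE q n Eq)/base_eqE[h0 h1 h2];
  rewrite ?h0 ?h1 ?h2 subrr.
Qed.

Section Phase.
Context (A : R4 -> R4).
Hypotheses (mA : engel_map E A) (bA : forall p, E p -> base (A p) = base p).

(** Half the vertical displacement, which is the angle between the line of the
distribution in the contact plane at [q] and its counterpart at [A q]. *)
Definition phase (q : R4) : R := (A q 0 3 - q 0 3) / 2.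

Lemma phase_diff p : E p -> differentiable phase p.
Proof.
move=> Ep; rewrite (_ : phase = (fun q => A q 0 3 - q 0 3) * cst 2^-1)//.
apply: differentiableM; last exact: differentiable_cst.
apply: differentiableB; last exact: differentiable_coord.
exact: (differentiable_entry 0 3 (em_diff mA Ep)).
Qed.

Lemma sin_phase p : E p -> sin (phase p) = 0.
Proof.
move=> Ep.
have [_ [k [kx ky]]] := image_dist_D mA Ep (dist_D_frame_B p).
have DE i h : (forall q, E q -> A q 0 i = q 0 i) -> 'D_h (component A i) p = h 0 i.
  move=> Ai; rewrite -(derive_coord p h i); apply: near_eq_derive.
  by apply: filterS (near_open oE Ep) => q /Ai.
have [e0 e1 _ _] := frame_BE p.
rewrite DE in kx; last by move=> q /bA/base_eqE[].
rewrite DE in ky; last by move=> q /bA/base_eqE[].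
have cE' : cos (p 0 3 / 2) = k * cos (A p 0 3 / 2) by rewrite -e0; exact: kx.
have sE' : sin (p 0 3 / 2) = k * sin (A p 0 3 / 2) by rewrite -e1; exact: ky.
by rewrite /phase mulrBl sinB cE' sE'; ring.
Qed.

Lemma derive_phase p : E p -> 'D_d_theta phase p = 0.
Proof.
move=> Ep; have := derive_eq0 oE d_theta Ep sin_phase.
have D := is_derive_comp1 d_theta (phase_diff Ep) (is_derive_sin _).
rewrite (_ : (fun q => sin (phase q)) = sin \o phase)// (@derive_val _ _ _ _ _ _ _ D).
move/eqP; rewrite mulf_eq0 => /orP[/eqP c0|/eqP//].
have /eqP := cos2Dsin2 (phase p).
by rewrite c0 sin_phase// expr0n /= addr0 eq_sym oner_eq0.
Qed.

Lemma phase_leaf p q : E p -> E q -> base p = base q -> phase p = phase q.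
Proof.
wlog pq : p q / p 0 3 <= q 0 3 => [H|] Ep Eq e.
  by have [/H|/ltW/H] := leP (p 0 3) (q 0 3); [exact|move=> h; apply/esym/h].
have eq := vertical_eq e; have s0 : 0 <= q 0 3 - p 0 3 by rewrite subr_ge0.
move: Eq; rewrite eq => Eq; apply/esym.
by apply: (leaf_constant cE s0 Ep Eq) => r Er; [exact: phase_diff|exact: derive_phase].
Qed.

(** On the leaf, [A] is a translation of a bounded open interval into itself. A
nonzero translation [c] would push the points within [c] of one end out of it. *)
Lemma phase_fixed p n : E p -> base p = x n -> A p 0 3 - p 0 3 = 0.
Proof.
move=> Ep bp; set c := A p 0 3 - p 0 3.
pose lo : R := - (n.+1%:R * pi); pose hi : R := n.+1%:R * pi + eps.
have inE t : lo < t < hi -> E (point4 (x n) t).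
  by move=> h; apply/in_domain => i; rewrite base_point4 point4_theta => /x_inj <-.
have stay t : lo < t < hi -> lo < t + c < hi.
  move=> ht; have Et := inE t ht.
  have bt : base (point4 (x n) t) = x n by exact: base_point4.
  have := (in_domain _ _ _).1 (em_stable mA Et) n; rewrite bA// bt => /(_ erefl).
  have : phase p = phase (point4 (x n) t) by apply: phase_leaf => //; rewrite bt.
  rewrite /phase point4_theta -/lo -/hi -/c.
  set T := A _ 0 3 => e.
  by have -> : T = t + c; first lra.
have /andP[h1 h2] : lo < p 0 3 < hi := (in_domain _ _ _).1 Ep n bp.
have [c0|c0|//] := ltgtP c 0.
(* The point tested is as close to the end as [c] requires, and no further
   from it than [p], so that it lies in the interval. *)
- have := stay (Num.min (p 0 3) (lo - c)).
  rewrite lt_min gt_min h1 h2 /= => /(_ _)/andP[|+ _]; first lra.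
  by rewrite -ltrBlDr lt_min ltxx andbF.
- have := stay (Num.max (p 0 3) (hi - c)).
  rewrite gt_max lt_max h1 h2 /= => /(_ _)/andP[|_ +]; first lra.
  by rewrite -ltrBrDr gt_max ltxx andbF.
Qed.

Lemma engel_map_id p : E p -> A p = p.
Proof.
move=> Ep; apply: base_inj; first exact: bA.
apply/eqP; rewrite -subr_eq0; apply/eqP.
apply: (@dense_eq0 _ _ _ x_dense eps_gt0 (fun q => A q 0 3 - q 0 3) p Ep) => //.
  apply: differentiable_continuous; apply: differentiableB.
    exact: (differentiable_entry 0 3 (em_diff mA Ep)).
  exact: differentiable_coord.
exact: phase_fixed.
Qed.

End Phase.
End Final.

Lemma ambientE {R : realType} (E : set 'rV[R]_4) (f : E -> E) (p : E) :
  ambient f (val p) = val (f p).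
Proof. exact: (congr1 (@^~ p) (valLK _ (fun p : E => val (f p)))). Qed.

Lemma ambientP {R : realType} (E : set 'rV[R]_4) (f : E -> E) p (Ep : E p) :
  ambient f p = val (f (SigSub (mem_set Ep))).
Proof. by rewrite -ambientE. Qed.

Theorem theorem2p13 (R : realType) (x : nat -> 'rV[R]_3) (eps : R)
    (x_inj : injective x) (x_dense : dense (range x))
    (eps_gt0 : 0 < eps) (eps_le : eps <= 2 * pi) :
  engel_manifold (domain_E x eps) dist_D /\
  Aut (domain_E x eps) dist_D = [set id].
Proof.
have oE := @domain_open R x eps eps_gt0.
split; first exact: engel_manifold_D.
set E := domain_E x eps in oE *.
apply/seteqP; split=> [f [[sf [g [fg gf sg]]] fD]|f ->] /=.
  have stable (h : E -> E) p : E p -> E (ambient h p).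
    by move=> Ep; rewrite (ambientP _ Ep); exact: set_mem (valP _).
  have cancel_ambient (h k : E -> E) p : cancel h k -> E p -> ambient k (ambient h p) = p.
    by move=> hk Ep; rewrite (ambientP h Ep) ambientE hk.
  have [mf mg] : engel_map E (ambient f) /\ engel_map E (ambient g).
    apply: engel_map_inverse => //.
    - exact: stable.
    - exact: stable.
    - by move=> p; exact: cancel_ambient.
    - by move=> p; exact: cancel_ambient.
    move=> p v Ep Dv; rewrite deriveE; last by have [d _] := sf 1%N; exact: d.
    by rewrite {1}(ambientP f Ep); exact: fD.
  have bf p : E p -> base (ambient f p) = base p.
    apply: (engel_map_base x_inj x_dense eps_gt0 eps_le mf mg) => q.
    exact: cancel_ambient.
  apply/funext => p; apply: val_inj; rewrite -ambientE.
  exact: (engel_map_id x_inj x_dense eps_gt0 mf bf (set_mem (valP p))).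
have idE p : E p -> p = ambient (@id E) p by move=> Ep; rewrite (ambientP _ Ep).
have sid : smooth_on E (ambient (@id E)).
  by move=> k; apply: class_C_eq (@class_C_id _ _ E k).
split; first by split => //; exists id; split.
move=> p v; rewrite -deriveE; last first.
  by have [d _] := sid 1%N; apply: d; exact: set_mem (valP p).
rewrite -(@near_eq_derive _ _ _ id) ?derive_id//.
by apply: filterS (near_open oE (set_mem (valP p))) => q /idE.
Qed.
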